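(* Let $G$ be a group which admits a $C'(\frac16)$ small cancellation presentation $G=\langle S\mid R\rangle$ with $S$ finite, where each $r\in R$ is cyclically reduced and no word in $R$ can be obtained from any other via cyclic conjugation and/or inversion. If there are constants $d>1$, $C\ge 0$ and an infinite subset $I\subseteq\mathbb N$ such that for each $n\in I$, $$|\{r\in R : n-C\le |r|\le n\}|>d^n,$$ then the Cayley graph $X=\mathrm{Cay}(G,S)$ admits exponentially many fat bigons.
   Context: $|r|$ denotes the length of the word $r$. The presentation $\langle S\mid R\rangle$ is $C'(\frac16)$ if, with $R^*$ the set of all cyclic conjugates of elements of $R$ and their inverses, any common initial subword of two distinct elements $r,r'\in R^*$ has length less than $\frac16\min(|r|,|r'|)$. All graphs are connected, have uniformly bounded degree, and are metric spaces with the shortest path metric (edges of length 1). For $t\ge 0$, $B_t(x)$ is the closed ball of radius $t$ about $x$, and $N_t(Y)=\{x : d(x,Y)\le t\}$. Let $X$ be a graph with base vertex $x_0$, and let $x$ be a vertex. Given $L\ge 1$ and $s,C\ge 0$, an $(L,s,C)$-bigon at $x$ is a pair of paths $\alpha_1,\alpha_2$ in $X$ from $x_0$ to $x$ such that (1) the length satisfies $l(\alpha_i)\le L\,d(x_0,x)$ for $i=1,2$; (2) with $B=N_C(\{x_0,x\})$, we have $d(\alpha_1\setminus B,\alpha_2\setminus B)>s$ (this holds by convention if one of the two sets is empty). Let $\mathcal B^X(L,s,C)$ be the set of vertices $x$ such that there exists an $(L,s,C)$-bigon at $x$. $X$ has (or admits) exponentially many fat bigons at $x_0$ if there exist constants $s_0,c,L>1$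 such that for every $s\ge s_0$ there exists $C$ such that $|\mathcal B^X(L,s,C)\cap B_n(x_0)|\ge c^n$ for infinitely many $n\in\mathbb N$. This property does not depend on the choice of $x_0$. *)

(* Defs.v *)
From HB Require Import structures.
From mathcomp Require Import all_boot all_order all_algebra.
From mathcomp Require Import finmap.
From mathcomp Require Import all_classical all_reals ereal.

Set Implicit Arguments.
Unset Strict Implicit.
Unset Printing Implicit Defensive.

Import Order.TTheory GRing.Theory Num.Theory.
Local Open Scope classical_set_scope.
Local Open Scope ring_scope.

Section Words.
Variable S : finType.

(* (a, false) is the letter a, (a, true) is its formal inverse. *)
Definition letter : Type := (S * bool)%type.
Definition word : Type := seq letter.

Definition inv_letter (a : letter) : letter := (a.1, ~~ a.2).
Definition inv_word (w : word) : word := rev (map inv_letter w).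

(* [cycle] also compares the last letter with the first one. *)
Definition cyclically_reduced (w : word) : bool :=
  cycle (fun a b : letter => b != inv_letter a) w.

(* The set R^* of cyclic conjugates of relators and of their inverses. *)
Definition symmetrized (Rel : set word) : set word :=
  [set w | exists2 r, Rel r & exists k, w = rot k r \/ w = rot k (inv_word r)].

Definition irredundant (Rel : set word) : Prop :=
  forall r r' k, Rel r -> Rel r' ->
    r' = rot k r \/ r' = rot k (inv_word r) -> r' = r.

(* The small cancellation condition C'(lambda). *)
Definition small_cancellation (R : realType) (lambda : R) (Rel : set word)
    : Prop :=
  forall r r' p : word, symmetrized Rel r -> symmetrized Rel r' -> r <> r' ->
    prefix p r -> prefix p r' ->
    (size p)%:R < lambda * (minn (size r) (size r'))%:R.

(* Equality in the group <S | Rel>: the congruence on words generated by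
   free reduction and by the relators. *)
Inductive presented_eq (Rel : set word) : word -> word -> Prop :=
| presented_refl w : presented_eq Rel w w
| presented_sym w w' : presented_eq Rel w w' -> presented_eq Rel w' w
| presented_trans w1 w2 w3 :
    presented_eq Rel w1 w2 -> presented_eq Rel w2 w3 -> presented_eq Rel w1 w3
| presented_cancel u a v :
    presented_eq Rel (u ++ [:: a; inv_letter a] ++ v) (u ++ v)
| presented_relator u r v :
    Rel r -> presented_eq Rel (u ++ r ++ v) (u ++ v).

Section Group.
Variables (G : groupType) (gen : S -> G).

Definition eval_letter (a : letter) : G :=
  (if a.2 then (gen a.1)^-1 else gen a.1)%g.

Definition eval_word (w : word) : G :=
  foldr (fun a g => eval_letter a * g)%g 1%g w.

(* G = <S | Rel>: evaluation of words induces an isomorphism from the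
   presented group onto G. *)
Definition is_presentation (Rel : set word) : Prop :=
  (forall g : G, exists w, eval_word w = g) /\
  (forall w w', eval_word w = eval_word w' <-> presented_eq Rel w w').

Definition cayley : rel G := fun g h =>
  (g != h) && [exists s : S, (h == g * gen s)%g || (g == h * gen s)%g].

End Group.
End Words.

(* A graph is given by its adjacency relation e, which is meant to be
   symmetric, irreflexive and connected. *)
Section Graphs.
Variables (R : realType) (V : choiceType) (e : rel V).

Definition is_walk (x y : V) (p : seq V) : bool := path e x p && (last x p == y).

Definition gdist (x y : V) : R :=
  inf [set (size p)%:R | p in [set p | is_walk x y p]].

(* Points of the geometric realization. The triple (u, v, t) is the point at
   distance t from u on the edge from u to v, so that (u, v, t) and
   (v, u, 1 - t) represent the same point, as do all (u, v, 0) and (u, u, 0).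
   Points are compared only through pdist, which does not depend on the
   representative. *)
Definition point : Type := (V * V * R)%type.
Definition vertex_point (x : V) : point := (x, x, 0).

Definition realization : set point :=
  [set q | (e q.1.1 q.1.2 /\ 0 <= q.2 <= 1) \/ exists x, q = vertex_point x].

Definition vdist (q : point) (x : V) : R :=
  let: (u, v, t) := q in Num.min (t + gdist u x) (1 - t + gdist v x).

(* Path metric on the realization: a shortest path between two points either
   passes through endpoints of their edges or stays inside a common edge. *)
Definition pdist (q q' : point) : R :=
  let: (u, v, t) := q in
  let: (u', v', t') := q' in
  let d := Num.min (t' + vdist q u') (1 - t' + vdist q v') in
  if (u, v) == (u', v') then Num.min d `|t - t'|
  else if (u, v) == (v', u') then Num.min d `|1 - t - t'|
  else d.

(* Equal to +oo if one of the sets is empty. *)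
Definition set_dist (A B : set point) : \bar R :=
  ereal_inf [set z | exists q q', [/\ A q, B q' & z = (pdist q q')%:E]].

Definition nbhd (t : R) (Y : set point) : set point :=
  [set q | realization q /\ (set_dist [set q] Y <= t%:E)%E].

(* The subset of the realization covered by the edge path x :: p. *)
Definition trace (x : V) (p : seq V) : set point :=
  [set q | (exists2 y, y \in x :: p & q = vertex_point y) \/
           (q.1 \in zip (x :: p) p /\ 0 <= q.2 <= 1)].

Definition bigon (L s C : R) (x0 x : V) (p1 p2 : seq V) : Prop :=
  let B := nbhd C [set vertex_point x0; vertex_point x] in
  [/\ is_walk x0 x p1 /\ is_walk x0 x p2,
      (size p1)%:R <= L * gdist x0 x,
      (size p2)%:R <= L * gdist x0 x &
      (s%:E < set_dist (trace x0 p1 `\` B) (trace x0 p2 `\` B))%E].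

Definition bigon_set (x0 : V) (L s C : R) : set V :=
  [set x | exists p1 p2, bigon L s C x0 x p1 p2].

Definition vertex_ball (x0 : V) (t : R) : set V := [set x | gdist x0 x <= t].

(* [fset_set A] is the finite set A only if A is finite; here this holds
   because balls of graphs of bounded degree are finite. *)
Definition exp_many_fat_bigons (x0 : V) : Prop :=
  exists s0 c L : R, [/\ 1 < s0, 1 < c, 1 < L &
    forall s, s0 <= s -> exists2 C, 0 <= C &
      infinite_set [set n : nat |
        c ^+ n <= #|` fset_set (bigon_set x0 L s C `&` vertex_ball x0 n%:R)|%:R]].

End Graphs.

(* Main.v *)
Require Import Defs.
From HB Require Import structures.
From mathcomp Require Import all_boot all_order all_algebra.
From mathcomp Require Import fingroup perm zmodp.
From mathcomp Require Import finmap.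
From mathcomp Require Import all_classical all_reals ereal.
From mathcomp Require Import zify lra.

(** Why the theorem holds. In a C'(1/6) group the loop in the Cayley graph
    labelled by a relator [r] is isometrically embedded, so its two halves are
    two paths from the base point to the vertex [midpoint r], of lengths
    [|r|/2] up to rounding, and points of the two halves which are both far
    from the two ends are far from each other: this is a fat bigon. Moreover
    different relators have different midpoints, so exponentially many relators
    of length close to [n] give exponentially many fat bigons in the ball of
    radius [n].

    Both facts come from one statement, [geodesic_of_relator]: if [p ++ h] is a
    cyclic conjugate of a relator or of its inverse, if [q] is a geodesic word,
    and if [p ++ q] is trivial in the group, then [q] is one of the two
    obvious candidates [inv_word p] and [h]. It is proved with van Kampen diagrams:
    by [van_kampen] the word [p ++ q] bounds a diagram, and cancelling at the two
    corners of the boundary, or removing a cell which is the mirror image of its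
    neighbour (or of the relator [p ++ h] along the boundary), gives a smaller
    instance. If nothing can be removed, two cells, or a cell and the side [p],
    share less than a sixth of the cell, and a cell shares at most half of itself
    with the geodesic side [q]. Euler's formula makes this impossible
    ([no_reduced_diagram]): the sphere made of the cells and of the
    outer face has total curvature at least 12 when a face with [k] corners where
    three or more edges meet has curvature [6 - k]. A cell only gets a positive
    curvature by being adjacent to [q] or to one of the two corners of the
    boundary; along [q] the outer face has a branch corner to compensate for it,
    and the two corners of the boundary do not provide enough.

    A diagram is a list of faces, each a cyclic list of darts (oriented edges),
    with an involution exchanging the two darts of an edge. Planarity is replaced
    by simple connectedness: every closed 1-cochain with values in a group is
    the coboundary of a vertex potential ([simply_connected]). This condition
    survives all gluing operations by short computations without any case
    distinction on how the vertices merge or split; over the field with two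
    elements it gives the inequality V - E + F >= 2 ([euler_F2]) by comparing ranks
    of matrices; and with values in the group itself it develops the diagram in
    the Cayley graph. *)

Set Implicit Arguments.
Unset Strict Implicit.
Unset Printing Implicit Defensive.

Import Order.TTheory GRing.Theory Num.Theory.
Local Open Scope nat_scope.

(** * Inverse words and diagrams *)

Section InverseWords.
Variable S : finType.
Implicit Types (a : letter S) (u v w : word S).

Lemma inv_letterK : involutive (@inv_letter S).
Proof. by case=> s b; rewrite /inv_letter /= negbK. Qed.

Lemma inv_letter_neq a : inv_letter a != a.
Proof. by case: a => s b; rewrite /inv_letter /eq_op /= eqxx; case: b. Qed.

Lemma inv_wordK : involutive (@inv_word S).
Proof.
by move=> w; rewrite /inv_word map_rev revK -map_comp map_id_in // => a _; exact: inv_letterK.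
Qed.

Lemma inv_word_cat u v : inv_word (u ++ v) = inv_word v ++ inv_word u.
Proof. by rewrite /inv_word map_cat rev_cat. Qed.

Lemma inv_word_cons a w : inv_word (a :: w) = rcons (inv_word w) (inv_letter a).
Proof. by rewrite /inv_word /= rev_cons. Qed.

Lemma inv_word_rcons a w : inv_word (rcons w a) = inv_letter a :: inv_word w.
Proof. by rewrite /inv_word map_rcons rev_rcons. Qed.

Lemma size_inv_word w : size (inv_word w) = size w.
Proof. by rewrite size_rev size_map. Qed.

Lemma inv_word_rot1 w : inv_word (rot 1 w) = rotr 1 (inv_word w).
Proof.
by case: w => [|a w] //; rewrite rot1_cons inv_word_rcons inv_word_cons rotr1_rcons.
Qed.

End InverseWords.

Section Potentials.
Variable H : groupType.
Implicit Types (f h : nat -> H) (c : H) (s : seq nat).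

(** The value of the group-valued cochain [h] along the path [s]. *)
Definition holonomy h s : H := foldr (fun x g => h x * g)%g 1%g s.

Lemma holonomy_cat h s1 s2 : holonomy h (s1 ++ s2) = (holonomy h s1 * holonomy h s2)%g.
Proof. by elim: s1 => [|x s1 IH] /=; rewrite ?mul1g // IH mulgA. Qed.

Lemma eq_in_holonomy h h' s : {in s, h =1 h'} -> holonomy h s = holonomy h' s.
Proof.
elim: s => //= x s IH eqh; rewrite eqh ?mem_head // IH // => y ys.
by rewrite eqh // in_cons ys orbT.
Qed.

(** [f] assigns to each dart of the path [s] the potential of its origin, that
    of the first dart being [c], and it grows by [h] along each dart. *)
Fixpoint potential f h c s : Prop :=
  if s is x :: s' then f x = c /\ potential f h (c * h x)%g s' else True.

Lemma potential_cat f h c s1 s2 :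
  potential f h c (s1 ++ s2) <-> potential f h c s1 /\ potential f h (c * holonomy h s1)%g s2.
Proof.
elim: s1 c => [|x s1 IH] c /=; first by rewrite mulg1; tauto.
by rewrite IH mulgA; tauto.
Qed.

Lemma eq_in_potential f f' h h' c s : {in s, f =1 f'} -> {in s, h =1 h'} ->
  potential f h c s -> potential f' h' c s.
Proof.
elim: s c => //= x s IH c eqf eqh [fx ps].
have xs : x \in x :: s by rewrite mem_head.
rewrite -(eqf _ xs) -(eqh _ xs); split=> //; apply: IH ps => y ys.
  by apply: eqf; rewrite in_cons ys orbT.
by apply: eqh; rewrite in_cons ys orbT.
Qed.

End Potentials.

Section Diagrams.
Variable S : finType.
Implicit Types (fs : seq (seq nat)) (s : seq nat) (al : nat -> nat)
  (lab : nat -> letter S).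

(** The first cohomology of the closed surface glued from the faces [fs] along
    [al] vanishes for all coefficient groups, with [f x] the value of a potential
    at the origin of the dart [x]. Since the group need not be abelian, the sum of
    a cochain around a face becomes an ordered product, which is trivial or not
    independently of the starting dart. *)
Definition simply_connected fs al : Prop :=
  forall (H : groupType) (h : nat -> H),
    {in flatten fs, forall x, h (al x) = (h x)^-1%g} ->
    {in fs, forall s, holonomy h s = 1%g} ->
  exists f, {in flatten fs, forall x, f (al x) = (f x * h x)%g} /\
            forall s, s \in fs -> exists c, potential f h c s.

(** The outer face has no special status here: its boundary word is read from
    the list of its darts in the same way as for the cells. *)
Record diagram fs al lab : Prop := Diagram {
  dg_uniq : uniq (flatten fs);
  dg_mem : {in flatten fs, forall x, al x \in flatten fs};
  dg_invol : {in flatten fs, forall x, al (al x) = x};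
  dg_lab : {in flatten fs, forall x, lab (al x) = inv_letter (lab x)};
  dg_sc : simply_connected fs al }.

Lemma diagram_perm fs fs' al lab :
  perm_eq fs fs' -> diagram fs al lab -> diagram fs' al lab.
Proof.
move=> pf [un me iv la sc].
have pF := perm_flatten pf.
have mF x : (x \in flatten fs') = (x \in flatten fs) by rewrite (perm_mem pF).
split.
- by rewrite -(perm_uniq pF).
- by move=> x; rewrite !mF; apply: me.
- by move=> x; rewrite !mF; apply: iv.
- by move=> x; rewrite !mF; apply: la.
move=> H h hal hfs; have [] := sc H h.
- by move=> x xin; apply: hal; rewrite mF.
- by move=> s sin; apply: hfs; rewrite -(perm_mem pf).
move=> f [fal fpot]; exists f; split.
- by move=> x; rewrite mF; apply: fal.
- by move=> s; rewrite -(perm_mem pf); apply: fpot.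
Qed.

Lemma diagram_rot s1 s2 fs al lab :
  diagram ((s1 ++ s2) :: fs) al lab -> diagram ((s2 ++ s1) :: fs) al lab.
Proof.
move=> [un me iv la sc].
have pF : perm_eq (flatten ((s1 ++ s2) :: fs)) (flatten ((s2 ++ s1) :: fs)).
  by rewrite /= perm_cat2r perm_catC.
have mF := perm_mem pF.
split.
- by rewrite -(perm_uniq pF).
- by move=> x; rewrite -!mF; apply: me.
- by move=> x; rewrite -!mF; apply: iv.
- by move=> x; rewrite -!mF; apply: la.
move=> H h hal hfs; have [] := sc H h.
- by move=> x; rewrite mF; apply: hal.
- move=> s; rewrite in_cons => /orP[/eqP->|sin]; last first.
    by apply: hfs; rewrite in_cons sin orbT.
  have := hfs _ (mem_head _ _); rewrite !holonomy_cat => /(congr1 (fun g => (holonomy h s1 * g * (holonomy h s1)^-1)%g)).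
  by rewrite mulg1 mulgV !mulgA mulgK.
move=> f [fal fpot]; exists f; split.
- by move=> x; rewrite -mF; apply: fal.
move=> s; rewrite in_cons => /orP[/eqP->|sin]; last first.
  by apply: fpot; rewrite in_cons sin orbT.
have [c] := fpot _ (mem_head _ _); rewrite potential_cat => -[p1 p2].
exists (c * holonomy h s1)%g; rewrite potential_cat; split=> //.
have := hfs _ (mem_head _ _); rewrite holonomy_cat => h21.
suff <- : (c = c * holonomy h s1 * holonomy h s2)%g by [].
suff h12 : (holonomy h s1 * holonomy h s2 = 1)%g by rewrite -mulgA h12 mulg1.
have := congr1 (fun g => (holonomy h s1 * g * (holonomy h s1)^-1)%g) h21.
by rewrite mulg1 mulgV !mulgA mulgK.
Qed.

Lemma diagram_drop fs al lab :
  diagram ([::] :: fs) al lab -> diagram fs al lab.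
Proof.
move=> [un me iv la sc]; split=> // H h hal hfs; have [] := sc H h => //.
  by move=> s; rewrite in_cons => /orP[/eqP->|] //; apply: hfs.
move=> f [fal fpot]; exists f; split=> // s sin; apply: fpot.
by rewrite in_cons sin orbT.
Qed.

(** Pinching a face at two of its corners: a cochain which is closed on both parts
    is closed on the old face, and the potential found there is still valid. *)
Lemma diagram_split s1 s2 fs al lab :
  diagram ((s1 ++ s2) :: fs) al lab -> diagram (s1 :: s2 :: fs) al lab.
Proof.
move=> [un me iv la sc].
split; rewrite /= ?catA // => H h hal hfs.
have h1 : holonomy h s1 = 1%g by apply: hfs; rewrite mem_head.
have h2 : holonomy h s2 = 1%g by apply: hfs; rewrite !in_cons eqxx orbT.
have [] := sc H h.
- by move=> x xin; apply: hal; move: xin; rewrite /= catA.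
- move=> s; rewrite in_cons => /orP[/eqP->|sin]; first by rewrite holonomy_cat h1 h2 mulg1.
  by apply: hfs; rewrite !in_cons sin !orbT.
move=> f [fal fpot]; exists f; split; first by move=> z; rewrite /= catA; apply: fal.
move=> s; have [c] := fpot _ (mem_head _ _); rewrite potential_cat h1 mulg1 => -[p1 p2].
rewrite !in_cons => /or3P[/eqP->|/eqP->|sin]; [by exists c|by exists c|].
by apply: fpot; rewrite in_cons sin orbT.
Qed.

(** Erasing an edge between two faces: a cochain on the remaining darts extends
    to the edge in exactly one way which is closed on both old faces. *)
Lemma diagram_merge x y s1 s2 fs al lab : al x = y ->
  diagram ((x :: s1) :: (y :: s2) :: fs) al lab ->
  diagram ((s2 ++ s1) :: fs) al lab.
Proof.
move=> axy [un me iv la sc].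
set F := flatten ((s2 ++ s1) :: fs).
have pF : perm_eq (flatten ((x :: s1) :: (y :: s2) :: fs)) (x :: y :: F).
  by apply/seq.permP => a; rewrite /F /= !count_cat /= !count_cat; lia.
have mF := perm_mem pF.
have := un; rewrite (perm_uniq pF) /= !in_cons negb_or => /andP[/andP[xy xF] /andP[yF uF]].
have ayx : al y = x by rewrite -axy iv // mF mem_head.
have sub z : z \in F -> z \in flatten ((x :: s1) :: (y :: s2) :: fs).
  by move=> zF; rewrite mF !in_cons zF !orbT.
have nx z : z \in F -> (z == x) = false by move=> zF; apply: contraNF xF => /eqP <-.
have ny z : z \in F -> (z == y) = false by move=> zF; apply: contraNF yF => /eqP <-.
have aF z : z \in F -> al z \in F.
  move=> zF; have := me _ (sub _ zF); rewrite mF !in_cons => /or3P[/eqP e|/eqP e|//].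
    by have := nx _ zF; have := ny _ zF; rewrite -(iv _ (sub _ zF)) e axy eqxx.
  by have := nx _ zF; rewrite -(iv _ (sub _ zF)) e ayx eqxx.
split=> //.
- by move=> z zF; rewrite iv // sub.
- by move=> z zF; rewrite la // sub.
move=> H h' hal hfs.
pose c := holonomy h' s2.
pose h z := if z == x then c else if z == y then c^-1%g else h' z.
have hF z : z \in F -> h z = h' z by move=> zF; rewrite /h nx // ny.
have hx : h x = c by rewrite /h eqxx.
have hy : h y = c^-1%g by rewrite /h eq_sym (negPf xy) eqxx.
have hs1 : holonomy h s1 = holonomy h' s1.
  by apply: eq_in_holonomy => z zs; apply: hF; rewrite /F /= !mem_cat zs ?orbT.
have hs2 : holonomy h s2 = holonomy h' s2.
  by apply: eq_in_holonomy => z zs; apply: hF; rewrite /F /= !mem_cat zs ?orbT.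
have h21 : (holonomy h' s2 * holonomy h' s1 = 1)%g by rewrite -holonomy_cat hfs // mem_head.
have [] := sc H h.
- move=> z; rewrite mF !in_cons => /or3P[/eqP->|/eqP->|zF].
  + by rewrite axy hx hy.
  + by rewrite ayx hx hy invgK.
  + by rewrite !hF ?aF // hal.
- move=> s; rewrite !in_cons => /or3P[/eqP->|/eqP->|sin] /=.
  + by rewrite hx hs1.
  + by rewrite hy hs2 mulVg.
  + rewrite -(hfs s) ?in_cons ?sin ?orbT //; apply: eq_in_holonomy => z zs; apply: hF.
    by rewrite /F /= !mem_cat; apply/orP; right; apply/flattenP; exists s.
move=> f [fal fpot]; exists f; split.
  by move=> z zF; rewrite fal ?sub // hF.
move=> s; rewrite in_cons => /orP[/eqP->|sin]; last first.
  have [|c0 p0] := fpot s; first by rewrite !in_cons sin !orbT.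
  exists c0; apply: eq_in_potential p0 => // z zs; apply: hF.
  by rewrite /F /= !mem_cat; apply/orP; right; apply/flattenP; exists s.
have [c1 [fx p1]] := fpot _ (mem_head _ _).
have [c2 [fy p2]] : exists c0, potential f h c0 (y :: s2) by apply: fpot; rewrite !in_cons eqxx orbT.
have e1 : (c2 = c1 * c)%g by rewrite -fy -axy fal ?mF ?mem_head // fx hx.
exists c1; rewrite potential_cat; split.
  have -> : (c1 = c2 * h y)%g by rewrite e1 hy mulgK.
  by apply: eq_in_potential p2 => // z zs; apply: hF; rewrite /F /= !mem_cat zs ?orbT.
rewrite -/c -hx.
by apply: eq_in_potential p1 => // z zs; apply: hF; rewrite /F /= !mem_cat zs ?orbT.
Qed.

(** The darts [x] and [y] disappear, and the edges which carried them become a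
    single edge. *)
Definition refold al x y z :=
  if z == al x then al y else if z == al y then al x else al z.

(** The old potential is a potential for the new diagram: the endpoints which get
    identified have the same potential, and a vertex that splits only imposes
    weaker conditions. In the case [al x = y] the edge is a spike, which is
    removed. *)
Lemma diagram_fold x y s fs al lab : lab y = inv_letter (lab x) ->
  diagram ((x :: y :: s) :: fs) al lab ->
  diagram (s :: fs) (refold al x y) lab.
Proof.
move=> lxy [un me iv la sc].
set F := flatten (s :: fs).
have mF : flatten ((x :: y :: s) :: fs) =i x :: y :: F by [].
have := un; rewrite /= !in_cons negb_or => /andP[/andP[xy xF] /andP[yF uF]].
rewrite -/(flatten (s :: fs)) -/F in xF yF uF.
have sub z : z \in F -> z \in flatten ((x :: y :: s) :: fs).
  by move=> zF; rewrite mF !in_cons zF !orbT.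
have xin : x \in flatten ((x :: y :: s) :: fs) by rewrite mF mem_head.
have yin : y \in flatten ((x :: y :: s) :: fs) by rewrite mF !in_cons eqxx orbT.
have nx z : z \in F -> (z == x) = false by move=> zF; apply: contraNF xF => /eqP <-.
have ny z : z \in F -> (z == y) = false by move=> zF; apply: contraNF yF => /eqP <-.
have axx : al x != x.
  by apply/eqP=> e; have := la _ xin; rewrite e => /esym/eqP; rewrite (negPf (inv_letter_neq _)).
have ayy : al y != y.
  by apply/eqP=> e; have := la _ yin; rewrite e => /esym/eqP; rewrite (negPf (inv_letter_neq _)).
have axy : al x = y -> al y = x by move=> <-; exact: iv.
have ayx : al y = x -> al x = y by move=> <-; exact: iv.
have axF : al x != y -> al x \in F.
  by move=> n; have := me _ xin; rewrite mF !in_cons (negPf axx) (negPf n).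
have ayF : al y != x -> al y \in F.
  by move=> n; have := me _ yin; rewrite mF !in_cons (negPf ayy) (negPf n).
have anxy : (al x == al y) = false.
  by apply/negbTE; apply: contraNneq xy => e; rewrite -(iv _ xin) e iv.
have rx : refold al x y (al x) = al y by rewrite /refold eqxx.
have ry : refold al x y (al y) = al x by rewrite /refold eq_sym anxy eqxx.
have cF z : z \in F -> [\/ z = al x /\ al x != y, z = al y /\ al y != x |
    [/\ z != al x, z != al y, al z \in F & refold al x y z = al z]].
  move=> zF; case: (eqVneq z (al x)) => [e|n1].
    by constructor 1; split=> //; rewrite -e ny.
  case: (eqVneq z (al y)) => [e|n2]; first by constructor 2; split=> //; rewrite -e nx.
  constructor 3; split=> //; last by rewrite /refold (negPf n1) (negPf n2).
  have := me _ (sub _ zF); rewrite mF !in_cons => /or3P[/eqP e|/eqP e|//].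
    by rewrite -(iv _ (sub _ zF)) e eqxx in n1.
  by rewrite -(iv _ (sub _ zF)) e eqxx in n2.
have axy' : (al x == y) = (al y == x) by apply/eqP/eqP.
split=> //.
- move=> z zF; case: (cF z zF) => [[-> n]|[-> n]|[_ _ azF ->] //].
    by rewrite rx; apply: ayF; rewrite -axy'.
  by rewrite ry; apply: axF; rewrite axy'.
- move=> z zF; case: (cF z zF) => [[-> n]|[-> n]|[n1 n2 azF ->]].
  + by rewrite rx ry.
  + by rewrite ry rx.
  + rewrite /refold; case: eqP => [e|_].
      by move: (nx _ zF); rewrite -(iv _ (sub _ zF)) e (iv _ xin) eqxx.
    case: eqP => [e|_]; last by rewrite iv // sub.
    by move: (ny _ zF); rewrite -(iv _ (sub _ zF)) e (iv _ yin) eqxx.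
- move=> z zF; case: (cF z zF) => [[-> n]|[-> n]|[n1 n2 azF ->]].
  + by rewrite rx !la // lxy.
  + by rewrite ry !la // lxy inv_letterK.
  + by rewrite la // sub.
move=> H h' hal hfs.
pose c := if al x == y then 1%g else (h' (al x))^-1%g.
pose h z := if z == x then c else if z == y then c^-1%g else h' z.
have hF z : z \in F -> h z = h' z by move=> zF; rewrite /h nx // ny.
have hx : h x = c by rewrite /h eqxx.
have hy : h y = c^-1%g by rewrite /h eq_sym (negPf xy) eqxx.
have hax : al x != y -> h' (al x) = c^-1%g by rewrite /c => /negPf ->; rewrite invgK.
have hay : al y != x -> h' (al y) = c.
  move=> n; rewrite /c axy' (negPf n) -hal -?rx //.
  by apply: axF; rewrite axy'.
have hsF s' : s' \in s :: fs -> {in s', h =1 h'}.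
  by move=> sin z zs; apply: hF; apply/flattenP; exists s'.
have [] := sc H h.
- move=> z; rewrite mF !in_cons => /or3P[/eqP->|/eqP->|zF].
  + rewrite hx; case: (eqVneq (al x) y) => [->|n]; first by rewrite hy.
    by rewrite hF ?hax // axF.
  + rewrite hy invgK; case: (eqVneq (al y) x) => [->|n]; first by rewrite hx.
    by rewrite hF ?hay // ayF.
  + rewrite (hF z) //; case: (cF z zF) => [[-> n]|[-> n]|[n1 n2 azF e]].
    * by rewrite iv // hx hax // invgK.
    * by rewrite iv // hy hay.
    * by rewrite hF // -e hal.
- move=> s'; rewrite in_cons => /orP[/eqP->|sin] /=.
  + rewrite hx hy mulKVg (eq_in_holonomy (hsF s _)) ?mem_head //.
    by rewrite hfs // mem_head.
  + by rewrite (eq_in_holonomy (hsF s' _)) ?hfs // in_cons sin orbT.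
move=> f [fal fpot]; exists f.
have [c0 [fx [fy p0]]] := fpot _ (mem_head _ _).
rewrite hx in fy; rewrite hx hy mulgK in p0.
split; last first.
  move=> s'; rewrite in_cons => /orP[/eqP->|sin].
    by exists c0; apply: eq_in_potential p0 => //; apply: hsF; rewrite mem_head.
  have [|c1 p1] := fpot s'; first by rewrite in_cons sin orbT.
  by exists c1; apply: eq_in_potential p1 => //; apply: hsF; rewrite in_cons sin orbT.
have fax := fal x xin; have fay := fal y yin.
rewrite fx hx in fax; rewrite fy hy mulgK in fay.
move=> z zF; case: (cF z zF) => [[-> n]|[-> n]|[n1 n2 azF ->]].
- by rewrite rx fay hax // fax mulgK.
- by rewrite ry fax hay // fay.
- by rewrite fal ?sub // hF.
Qed.

Lemma diagram_spike x y s fs al lab : lab y = inv_letter (lab x) ->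
  x != y -> x \notin flatten (s :: fs) -> y \notin flatten (s :: fs) ->
  al x = y -> al y = x ->
  diagram (s :: fs) al lab -> diagram ((x :: y :: s) :: fs) al lab.
Proof.
move=> lxy xy xF yF axy ayx [un me iv la sc].
set F := flatten (s :: fs) in un me iv la xF yF.
have mF : flatten ((x :: y :: s) :: fs) =i x :: y :: F by [].
have nx z : z \in F -> (z == x) = false by move=> zF; apply: contraNF xF => /eqP <-.
have ny z : z \in F -> (z == y) = false by move=> zF; apply: contraNF yF => /eqP <-.
split.
- have -> : flatten ((x :: y :: s) :: fs) = x :: y :: F by [].
  by rewrite /= in_cons negb_or xy xF yF.
- by move=> z; rewrite !mF !in_cons => /or3P[/eqP->|/eqP->|/me->]; rewrite ?axy ?ayx ?eqxx ?orbT.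
- by move=> z; rewrite !mF !in_cons => /or3P[/eqP->|/eqP->|/iv->]; rewrite ?axy ?ayx.
- move=> z; rewrite !mF !in_cons => /or3P[/eqP->|/eqP->|/la->]; rewrite ?axy ?ayx //.
  by rewrite lxy inv_letterK.
move=> H h hal hfs.
have hxy : h y = (h x)^-1%g by rewrite -axy hal // mF mem_head.
have hs : holonomy h s = 1%g.
  by have := hfs _ (mem_head _ _); rewrite /= hxy mulKVg.
have [] := sc H h.
- by move=> z zF; apply: hal; rewrite mF !in_cons zF !orbT.
- move=> s'; rewrite in_cons => /orP[/eqP->|sin] //; apply: hfs.
  by rewrite in_cons sin orbT.
move=> f [fal fpot].
have [c pc] := fpot _ (mem_head _ _).
pose g z := if z == x then c else if z == y then (c * h x)%g else f z.
have gF z : z \in F -> g z = f z by move=> zF; rewrite /g nx // ny.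
have gx : g x = c by rewrite /g eqxx.
have gy : g y = (c * h x)%g by rewrite /g eq_sym (negPf xy) eqxx.
exists g; split.
- move=> z; rewrite mF !in_cons => /or3P[/eqP->|/eqP->|zF].
  + by rewrite axy gx gy.
  + by rewrite ayx gx gy hxy mulgK.
  + by rewrite !gF ?me // fal.
move=> s'; rewrite in_cons => /orP[/eqP->|sin].
  exists c => /=; rewrite gx gy hxy mulgK; split=> //; split=> //.
  apply: eq_in_potential pc => // z zs; rewrite gF //.
  by apply/flattenP; exists s => //; rewrite mem_head.
have [|c1 p1] := fpot s'; first by rewrite in_cons sin orbT.
exists c1; apply: eq_in_potential p1 => // z zs; rewrite gF //.
by apply/flattenP; exists s' => //; rewrite in_cons sin orbT.
Qed.

End Diagrams.

(** * Words bounding a diagram over the relators *)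

Lemma diagram_ext (S : finType) fs al al' (lab lab' : nat -> letter S) :
  {in flatten fs, al =1 al'} -> {in flatten fs, lab =1 lab'} ->
  diagram fs al lab -> diagram fs al' lab'.
Proof.
move=> ea el [un me iv la sc]; split=> //.
- by move=> x xF; rewrite -ea // me.
- by move=> x xF; rewrite -!ea ?iv // me.
- by move=> x xF; rewrite -ea // -!el ?la // me.
move=> H h hal hfs; have [|//|f [fal fpot]] := sc H h.
  by move=> x xF; rewrite ea // hal.
by exists f; split=> // x xF; rewrite -ea // fal.
Qed.

Lemma map_eq_cat (T1 T2 : Type) (f : T1 -> T2) s (u v : seq T2) : map f s = u ++ v ->
  exists s1 s2, [/\ s = s1 ++ s2, map f s1 = u & map f s2 = v].
Proof.
move=> e; exists (take (size u) s), (drop (size u) s).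
by rewrite cat_take_drop map_take map_drop e take_size_cat // drop_size_cat.
Qed.

Section VanKampen.
Variables (S : finType) (Rel : set (word S)).
Implicit Types (u v w t : word S) (a : letter S).

Lemma symmetrized_rot1 w : symmetrized Rel w -> symmetrized Rel (rot 1 w).
Proof.
have key r k : exists j, rot 1 (rot k r) = rot j r :> word S.
  case: (ltnP k (size r)) => kr; last by exists 1; rewrite (rot_oversize kr).
  by exists k.+1; rewrite (rotS kr).
case=> r Rr [k [->|->]]; exists r => //.
  by have [j ->] := key r k; exists j; left.
by have [j ->] := key (inv_word r) k; exists j; right.
Qed.

Lemma symmetrized_rot n w : symmetrized Rel w -> symmetrized Rel (rot n w).
Proof.
move=> Rw; elim: n => [|n IH]; first by rewrite rot0.
case: (ltnP n (size w)) => nw; first by rewrite rotS //; exact: symmetrized_rot1.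
by rewrite rot_oversize ?leqW // -(rot_oversize nw).
Qed.

Lemma symmetrized_catC u v : symmetrized Rel (u ++ v) -> symmetrized Rel (v ++ u).
Proof. by move=> /(symmetrized_rot (size u)); rewrite rot_size_cat. Qed.

Lemma symmetrized_inv w : symmetrized Rel w -> symmetrized Rel (inv_word w).
Proof.
have key k r : exists j, inv_word (rot k r) = rot j (inv_word r) :> word S.
  exists (size (drop k r)); rewrite -{3}(cat_take_drop k r) inv_word_cat /rot inv_word_cat.
  by rewrite -(size_inv_word (drop k r)) drop_size_cat // take_size_cat.
case=> r Rr [k [->|->]]; exists r => //.
  by have [j ->] := key k r; exists j; right.
by have [j ->] := key k (inv_word r); exists j; left; rewrite inv_wordK.
Qed.

Lemma symmetrized_base r : Rel r -> symmetrized Rel r.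
Proof. by move=> Rr; exists r => //; exists 0; left; rewrite rot0. Qed.

(** [w] is the boundary word of a diagram with [k] cells. Boundary words of
    the cells are read against the orientation of the outer face, which is harmless
    as [symmetrized Rel] is closed under inversion. *)
Definition bounds k w : Prop := exists s0 fs al (lab : nat -> letter S),
  [/\ diagram (s0 :: fs) al lab, map lab s0 = w, size fs = k &
      forall s, s \in fs -> symmetrized Rel (map lab s)].

(** The letter only serves to define labels, for darts of which there are none. *)
Lemma bounds_nil : letter S -> bounds 0 [::].
Proof.
move=> a; exists [::], [::], id, (fun _ => a); split=> //; split=> // H h _ _.
exists (fun _ => 1%g); split=> // s; rewrite inE => /eqP->.
by exists 1%g.
Qed.

Lemma bounds_rot k u v : bounds k (u ++ v) -> bounds k (v ++ u).
Proof.
case=> s0 [fs [al [lab [D0 /map_eq_cat[s1 [s2 [e <- <-]]] sz R0]]]].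
exists (s2 ++ s1), fs, al, lab; split=> //; last by rewrite map_cat.
by apply: diagram_rot; rewrite -e.
Qed.

Lemma bounds_fold0 k a w : bounds k (a :: inv_letter a :: w) -> bounds k w.
Proof.
case=> s0 [fs [al [lab [D0 e sz R0]]]].
case: s0 e D0 => [|x [|y s]] //= [ex ey es] D0.
exists s, fs, (refold al x y), lab; split=> //.
by apply: diagram_fold D0; rewrite ey ex.
Qed.

Lemma bounds_fold k u v a : bounds k (u ++ [:: a; inv_letter a] ++ v) -> bounds k (u ++ v).
Proof. by move=> /bounds_rot/bounds_fold0/bounds_rot. Qed.

Lemma bounds_folds k u v w : bounds k (u ++ w ++ inv_word w ++ v) -> bounds k (u ++ v).
Proof.
elim/last_ind: w u v => [|w a IH] u v //=.
rewrite inv_word_rcons -cats1 -!catA /= => D0.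
by apply: IH; rewrite catA; apply: (@bounds_fold _ _ _ a); rewrite -catA.
Qed.

Lemma bounds_spike0 k a w : bounds k w -> bounds k (a :: inv_letter a :: w).
Proof.
case=> s0 [fs [al [lab [D0 e sz R0]]]].
pose F := flatten (s0 :: fs).
pose x := (\max_(z <- F) z).+1; pose y := x.+1.
have lt z : z \in F -> z < x by move=> zF; rewrite ltnS; apply: leq_bigmax_seq.
have nx z : z \in F -> (z == x) = false by move=> /lt /ltn_eqF.
have ny z : z \in F -> (z == y) = false by move=> /lt zx; apply: ltn_eqF; apply: ltnW.
pose al' z := if z == x then y else if z == y then x else al z.
pose lab' z := if z == x then a else if z == y then inv_letter a else lab z.
have yx : (y == x) = false by rewrite /y eqn_leq ltnn.
have lx : lab' x = a by rewrite /lab' eqxx.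
have ly : lab' y = inv_letter a by rewrite /lab' yx eqxx.
have lF : {in F, lab =1 lab'} by move=> z zF; rewrite /lab' nx // ny.
exists (x :: y :: s0), fs, al', lab'; split=> //.
- apply: diagram_spike; rewrite ?lx ?ly //.
  + by rewrite eq_sym yx.
  + by apply/negP => /lt; rewrite ltnn.
  + by apply/negP => /lt; rewrite ltnNge leqnSn.
  + by rewrite /al' eqxx.
  + by rewrite /al' yx eqxx.
  + by apply: diagram_ext D0 => // z zF; rewrite /al' nx // ny.
- rewrite /= lx ly -e; congr [:: _, _ & _]; apply/esym/eq_in_map => z zs.
  by apply: lF; rewrite /F /= mem_cat zs.
move=> s sin; rewrite -(_ : map lab s = map lab' s); first exact: R0.
apply/eq_in_map => z zs; apply: lF; rewrite /F /= mem_cat; apply/orP; right.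
by apply/flattenP; exists s.
Qed.

Lemma bounds_spike k u v a : bounds k (u ++ v) -> bounds k (u ++ [:: a; inv_letter a] ++ v).
Proof. by move=> /bounds_rot/(bounds_spike0 a) D0; apply: bounds_rot. Qed.

Lemma bounds_spikes k u v w : bounds k (u ++ v) -> bounds k (u ++ inv_word w ++ w ++ v).
Proof.
elim: w u v => [|a w IH] u v D0 //.
rewrite inv_word_cons -cats1 -!catA catA /=.
have := @bounds_spike k (u ++ inv_word w) (w ++ v) (inv_letter a).
by rewrite inv_letterK => Dsp; apply: Dsp; rewrite -catA; apply: IH.
Qed.

Lemma bounds_cut k u v : symmetrized Rel u -> bounds k (u ++ v) -> bounds k.+1 v.
Proof.
move=> Ru [s0 [fs [al [lab [D0 /map_eq_cat[s1 [s2 [e eu <-]]] sz R0]]]]].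
exists s2, (s1 :: fs), al, lab; split=> //.
- apply: diagram_perm (diagram_split (_ : diagram ((s1 ++ s2) :: fs) al lab)); rewrite -?e //.
  by rewrite (perm_catCA [:: s1] [:: s2]).
- by rewrite /= sz.
by move=> s; rewrite in_cons => /orP[/eqP->|/R0] //; rewrite eu.
Qed.

(** A new cell is created by growing the path [inv_word t ++ t] out of the
    boundary and pinching its first half off as a face of its own. *)
Lemma bounds_cell k u t v : symmetrized Rel t -> bounds k (u ++ v) ->
  bounds k.+1 (u ++ t ++ v).
Proof.
move=> Rt /(bounds_spikes t) /bounds_rot; rewrite -catA => D0.
by apply: bounds_rot; apply: bounds_cut D0; apply: symmetrized_inv.
Qed.

(** The existence half of van Kampen's lemma. Deleting a relator from the boundary
    word is also done by adding a cell, labelled by the inverse relator, and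
    folding. *)
Lemma bounds_presented w w' x y : presented_eq Rel w w' ->
  (exists k, bounds k (x ++ w ++ y)) <-> (exists k, bounds k (x ++ w' ++ y)).
Proof.
move=> ww; elim: ww x y => {w w'} //.
- by move=> w w' _ IH x y; rewrite IH.
- by move=> w1 w2 w3 _ IH1 _ IH2 x y; rewrite IH1.
- move=> u a v x y; rewrite -!catA (catA x) (catA x u (v ++ y)); split=> -[k D0]; exists k.
    exact: bounds_fold D0.
  exact: bounds_spike.
move=> u r v Rr x y; rewrite -!catA (catA x) (catA x u (v ++ y)); split=> -[k D0].
  exists k.+1; apply: (@bounds_folds _ _ _ r).
  rewrite catA; rewrite catA in D0; apply: bounds_cell D0.
  exact/symmetrized_inv/symmetrized_base.
by exists k.+1; apply: bounds_cell => //; exact: symmetrized_base.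
Qed.

End VanKampen.

(** * Euler's inequality *)

(** A vertex of degree 2 accounts for 3 + 3, a vertex of degree at least 3 for
    at least 2 + 2 + 2 on the right-hand side minus the sum. *)
Lemma card_porbits_ge3 (D : finType) (sg : {perm D}) : (forall d, sg d != d) ->
  6 * #|porbits sg| + \sum_(d : D) (sg (sg d) != d) <= 3 * #|D|.
Proof.
move=> nofix.
rewrite -[#|D|]sum1_card big_distrr /=.
rewrite -[#|porbits sg|]sum1_card big_distrr /=.
pose F d := 3 - (sg (sg d) != d).
have -> : \sum_(d : D) 3 * 1 = \sum_(d : D) F d + \sum_(d : D) (sg (sg d) != d).
  by rewrite -big_split; apply: eq_bigr => d _; rewrite /F; case: (_ != _).
rewrite leq_add2r (partition_big (porbit sg) (fun v => v \in porbits sg)) /=; last first.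
  by move=> d _; apply: imset_f.
apply: leq_sum => v /imsetP[d _ ->].
have pS x : porbit sg (sg x) == porbit sg x.
  by rewrite eq_porbit_mem; have := mem_porbit sg 1 x; rewrite expg1.
rewrite (bigD1 d) //= (bigD1 (sg d)) /=; last by rewrite pS nofix.
rewrite {1 2}/F; case: (eqVneq (sg (sg d)) d) => [e|n]; first by rewrite e eqxx.
rewrite /= (bigD1 (sg (sg d))) /=; last first.
  by rewrite (eqP (pS _)) pS n nofix.
by rewrite /F; do 2 case: (_ != _).
Qed.

Lemma addF2 (x : 'F_2) : (x + x = 0)%R.
Proof. by case: x => [[|[|]]] // i; apply/val_inj. Qed.

Lemma mxrank_lt_ker (F : fieldType) m n (u : 'rV[F]_m) (M : 'M[F]_(m, n)) :
  u != 0%R -> (u *m M = 0)%R -> \rank M < m.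
Proof.
move=> u0 uM; rewrite ltn_neqAle rank_leq_row andbT.
apply: contra u0 => rf; apply/eqP/(row_free_inj (rf : row_free M)).
by rewrite uM mul0mx.
Qed.

(** Closed cochains on the edges of a surface, over the field with two elements:
    they form the kernel of [A + B], where [A] imposes invariance under the
    involution and [B] closedness on the faces, and they are all coboundaries, that
    is in the image of [M]. The rank of [A] is at most half of the number of darts
    because [A] squares to zero; one is lost in the rank of [M] because
    constants have no coboundary, and another one in the rank of [A + B] because the
    sum of all the rows of [B] lies in the image of [A]. *)
Section EulerF2.
Variables (D K : finType) (al : D -> D) (sg : {perm D}) (face : D -> K).
(* A choice of one dart in each edge; it shows that the constant function 1 is
   in the image of [A]. *)
Variable half : D -> bool.
Hypothesis alK : involutive al.
Hypothesis half_al : forall d, half (al d) = ~~ half d.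
Hypothesis D_gt0 : 0 < #|D|.
Hypothesis exact_closed : forall h : D -> 'F_2,
  (forall d, h (al d) = h d) ->
  (forall k, \sum_(d | face d == k) h d = 0)%R ->
  exists f : D -> 'F_2, (forall d, f (sg d) = f d) /\
                        (forall d, h d = f (al d) + f d)%R.

Let n := #|D|.
Let P := porbits sg.
Let e : 'I_n -> D := enum_val.
Let eP : 'I_#|P| -> {set D} := enum_val.
Let A : 'M['F_2]_n := \matrix_(i, j) ((e i == e j)%:R + (al (e i) == e j)%:R)%R.
Let B : 'M['F_2]_(#|K|, n) := \matrix_(k, j) (face (e j) == enum_val k)%:R%R.
Let M : 'M['F_2]_(#|P|, n) :=
  \matrix_(v, j) ((al (e j) \in eP v)%:R + (e j \in eP v)%:R)%R.

Let sum_e (F : D -> 'F_2) : (\sum_(j < n) F (e j) = \sum_d F d)%R.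
Proof. by rewrite -(big_enum_val F). Qed.

Let sum_delta (F : D -> 'F_2) x : (\sum_d F d * (x == d)%:R = F x)%R.
Proof.
rewrite (bigD1 x) //= eqxx mulr1 big1 ?addr0 // => d dx.
by rewrite eq_sym (negPf dx) mulr0.
Qed.

Let A_sq : (A *m A = 0)%R.
Proof.
apply/matrixP => i j; rewrite !mxE.
pose F d : 'F_2 := (((d == e j)%:R + (al d == e j)%:R) * (e i == d)%:R +
     ((d == e j)%:R + (al d == e j)%:R) * (al (e i) == d)%:R)%R.
transitivity (\sum_d F d)%R.
  by rewrite -sum_e; apply: eq_bigr => k _; rewrite !mxE mulrC mulrDr.
rewrite big_split /= !(sum_delta (fun d => (d == e j)%:R + (al d == e j)%:R)%R) alK.
by rewrite [X in (_ + X)%R]addrC addF2.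
Qed.

Let rank_A : 2 * \rank A <= n.
Proof. by have := mulmx0_rank_max A_sq; rewrite mul2n -addnn. Qed.

Let rank_M : \rank M < #|P|.
Proof.
apply: (@mxrank_lt_ker _ _ _ (const_mx 1%R)).
  have [d _] : exists d, d \in D by apply/card_gt0P.
  have Pd : porbit sg d \in P by apply: imset_f.
  apply/eqP=> /rowP/(_ (enum_rank_in Pd (porbit sg d))).
  by rewrite !mxE => /eqP; rewrite oner_eq0.
apply/rowP=> j; rewrite !mxE.
have Pin x : (\sum_(v in P) (x \in v)%:R = 1 :> 'F_2)%R.
  rewrite (bigD1 (porbit sg x)) ?imset_f //= porbit_id big1 ?addr0 // => v /andP[vP nv].
  case xv: (x \in v) => //; case/negP: nv; move/imsetP: vP xv => [y _ ->].
  by rewrite eq_sym eq_porbit_mem.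
transitivity (\sum_(v in P) ((al (e j) \in v)%:R + (e j \in v)%:R : 'F_2))%R.
  by rewrite [RHS]big_enum_val; apply: eq_bigr => v _; rewrite !mxE mul1r.
by rewrite big_split /= !Pin addF2.
Qed.

Let rank_AB : \rank (A + B)%MS < \rank A + #|K|.
Proof.
have cap : ((const_mx 1%R : 'rV['F_2]_n) <= A :&: B)%MS.
  rewrite sub_capmx; apply/andP; split; apply/submxP.
    exists (\row_j (half (e j))%:R)%R; apply/rowP=> j; rewrite !mxE.
    pose F d : 'F_2 := ((half d)%:R * (e j == d)%:R + (half d)%:R * (al (e j) == d)%:R)%R.
    transitivity (\sum_d F d)%R; last first.
      rewrite -sum_e; apply: eq_bigr => k _; rewrite !mxE mulrDr /F (eq_sym (e j)).
      by congr (_ + _ * _%:R)%R; rewrite -(inj_eq (inv_inj alK)) alK eq_sym.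
    rewrite big_split /= !(sum_delta (fun d => (half d)%:R)%R) half_al.
    by case: (half _); rewrite ?addr0 ?add0r.
  exists (const_mx 1%R); apply/rowP=> j; rewrite !mxE.
  transitivity (\sum_(k : K) (face (e j) == k)%:R : 'F_2)%R.
    rewrite (bigD1 (face (e j))) //= eqxx big1 ?addr0 // => k.
    by rewrite eq_sym => /negPf ->.
  rewrite (big_enum_val (A := K) (fun k => (face (e j) == k)%:R)%R).
  by apply: eq_bigr => k _; rewrite !mxE mul1r.
have c1 : 0 < \rank (A :&: B)%MS.
  apply: leq_trans (mxrankS cap); rewrite lt0n mxrank_eq0.
  have [d _] : exists d, d \in D by apply/card_gt0P.
  by apply/eqP=> /rowP/(_ (enum_rank d)); rewrite !mxE => /eqP; rewrite oner_eq0.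
have := mxrank_sum_cap A B; have := rank_leq_row B; lia.
Qed.

Let ker_AB : (kermx (A + B)%MS^T <= M)%MS.
Proof.
apply/row_subP => i; set u := row i _.
have uC : (u *m (A + B)%MS^T = 0)%R by apply/sub_kermxP; exact: row_sub.
clearbody u.
have orth m (w : 'M_(m, n)) : (w <= A + B)%MS -> (u *m w^T = 0)%R.
  by case/submxP=> y ->; rewrite trmx_mul mulmxA uC mul0mx.
pose h d := u ord0 (enum_rank d).
have he j : h (e j) = u ord0 j by rewrite /h enum_valK.
have hal d : h (al d) = h d.
  have := orth _ _ (addsmxSl A B) => /matrixP/(_ ord0 (enum_rank d)); rewrite !mxE.
  pose F d' : 'F_2 := (h d' * (d == d')%:R + h d' * (al d == d')%:R)%R.
  have -> : (\sum_j u ord0 j * A^T j (enum_rank d) = \sum_d' F d')%R.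
    by rewrite -sum_e; apply: eq_bigr => k _; rewrite !mxE mulrDr /F he /e enum_rankK.
  rewrite big_split /= !(sum_delta h) => /eqP; rewrite addr_eq0 => /eqP ->.
  by apply/eqP; rewrite -addr_eq0 addF2.
have hf k : (\sum_(d | face d == k) h d = 0)%R.
  have := orth _ _ (addsmxSr A B) => /matrixP/(_ ord0 (enum_rank k)); rewrite !mxE => e0.
  rewrite -[RHS]e0 big_mkcond -sum_e; apply: eq_bigr => j _; rewrite !mxE -he enum_rankK.
  by case: (_ == _); rewrite ?mulr1 ?mulr0.
have [f [fsg fal]] := exact_closed hal hf.
have fP x y : x \in porbit sg y -> f x = f y.
  by case/porbitP=> i0 ->; elim: i0 => [|i0 IH]; rewrite ?expg0 ?perm1 // expgSr permM fsg.
pose g (v : {set D}) := if [pick x in v] is Some x then f x else 0%R.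
have gP x : (\sum_(v in P) g v * (x \in v)%:R = f x)%R.
  rewrite (bigD1 (porbit sg x)) ?imset_f //= porbit_id mulr1 big1 ?addr0 => [|v /andP[vP nv]].
    by rewrite /g; case: pickP => [y /fP//|/(_ x)]; rewrite porbit_id.
  case xv: (x \in v); rewrite ?mulr0 //; case/negP: nv; move/imsetP: vP xv => [y _ ->].
  by rewrite eq_sym eq_porbit_mem.
apply/submxP; exists (\row_v g (eP v))%R; apply/rowP => j.
rewrite -he fal [RHS]mxE -!gP -big_split /= [LHS]big_enum_val; apply: eq_bigr => v _.
by rewrite !mxE mulrDr.
Qed.

Lemma euler_F2 : n + 4 <= 2 * #|P| + 2 * #|K|.
Proof.
have := mxrankS ker_AB; rewrite mxrank_ker mxrank_tr.
have := rank_M; have := rank_AB; have := rank_A; lia.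
Qed.

End EulerF2.

(** * The combinatorial geometry of a diagram *)

Lemma next_head (T : eqType) (x : T) s : next (x :: s) x = head x s.
Proof. by case: s => [|y s] /=; rewrite eqxx. Qed.

Lemma potential_rot (H : groupType) (f h : nat -> H) c s i :
  holonomy h s = 1%g -> potential f h c s ->
  holonomy h (rot i s) = 1%g /\ exists c', potential f h c' (rot i s).
Proof.
rewrite /rot -{1 2}(cat_take_drop i s) !holonomy_cat potential_cat => h12 [p1 p2]; split.
  by apply: (mulgI (holonomy h (take i s))); rewrite mulgA h12 mul1g mulg1.
exists (c * holonomy h (take i s))%g; apply/potential_cat; split=> //.
by rewrite -mulgA h12 mulg1.
Qed.

Lemma potential_next (H : groupType) (f h : nat -> H) c s x :
  uniq s -> holonomy h s = 1%g -> potential f h c s -> x \in s ->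
  f (next s x) = (f x * h x)%g.
Proof.
move=> us hs ps xs; have [i s' e] := rot_to xs.
have [] := potential_rot i hs ps; rewrite -(next_rot i us) e next_head => hx [c' pc'].
case: s' pc' hx {e} => [|y s'] /= [fx]; last by case=> -> _; rewrite fx.
by rewrite mulg1 => _ ->; rewrite mulg1.
Qed.

Section Darts.
Implicit Types (fs : seq (seq nat)) (s : seq nat) (x : nat).

(** The face which contains a given dart; the value is empty outside the
    diagram. *)
Definition face fs x : seq nat := nth [::] fs (find (fun s => x \in s) fs).
Definition next_dart fs x := next (face fs x) x.
Definition prev_dart fs x := prev (face fs x) x.

Lemma uniq_flatten_mem fs s : uniq (flatten fs) -> s \in fs -> uniq s.
Proof.
elim: fs => //= s' fs IH; rewrite cat_uniq in_cons => /and3P[us' _ uF].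
by case/orP=> [/eqP->|/IH->].
Qed.

Lemma face_eq fs s x : uniq (flatten fs) -> s \in fs -> x \in s -> face fs x = s.
Proof.
elim: fs => //= s' fs IH; rewrite cat_uniq => /and3P[_ dis uF]; rewrite in_cons.
case/orP=> [/eqP-> xs|sin xs]; rewrite /face /=; first by rewrite xs.
have /negPf -> : x \notin s'; last exact: IH.
apply: contraNN dis => xs'; apply/hasP; exists x => //.
by apply/flattenP; exists s.
Qed.

Lemma face_mem fs x : x \in flatten fs -> face fs x \in fs /\ x \in face fs x.
Proof.
move=> /flattenP[s sin xs].
have hs : has (fun s => x \in s) fs by apply/hasP; exists s.
by rewrite /face mem_nth -?has_find //; split=> //; exact: (nth_find [::] hs).
Qed.

End Darts.

Section DiagramEuler.
Variable S : finType.
Variables (fs : seq (seq nat)) (al : nat -> nat) (lab : nat -> letter S).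
Hypothesis dg : diagram fs al lab.
Let F := flatten fs.
Let uF : uniq F := dg_uniq dg.

Lemma face_next_dart x : x \in F -> face fs (next_dart fs x) = face fs x /\ next_dart fs x \in F.
Proof.
move=> /face_mem[ff xf]; have nf : next_dart fs x \in face fs x by rewrite mem_next.
by split; [exact: (face_eq uF ff nf)|apply/flattenP; exists (face fs x)].
Qed.

Lemma face_prev_dart x : x \in F -> face fs (prev_dart fs x) = face fs x /\ prev_dart fs x \in F.
Proof.
move=> /face_mem[ff xf]; have nf : prev_dart fs x \in face fs x by rewrite mem_prev.
by split; [exact: (face_eq uF ff nf)|apply/flattenP; exists (face fs x)].
Qed.

Lemma next_dartK x : x \in F -> prev_dart fs (next_dart fs x) = x.
Proof.
move=> xF; rewrite /prev_dart (face_next_dart xF).1 prev_next //.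
by apply: (uniq_flatten_mem uF); exact: (face_mem xF).1.
Qed.

Lemma prev_dartK x : x \in F -> next_dart fs (prev_dart fs x) = x.
Proof.
move=> xF; rewrite /next_dart (face_prev_dart xF).1 next_prev //.
by apply: (uniq_flatten_mem uF); exact: (face_mem xF).1.
Qed.

(** Rotation around the origin of a dart. *)
Definition turn x := al (prev_dart fs x).

(** The origin of [x] has degree at least 3, provided there are no vertices of
    degree 1. *)
Definition branch x := turn (turn x) != x.

Lemma turn_mem x : x \in F -> turn x \in F.
Proof. by move=> xF; apply: (dg_mem dg); exact: (face_prev_dart xF).2. Qed.

Lemma turn_inj : {in F &, injective turn}.
Proof.
move=> x y xF yF /(congr1 al).
rewrite !(dg_invol dg) ?(face_prev_dart xF).2 ?(face_prev_dart yF).2 // => /(congr1 (next_dart fs)).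
by rewrite !prev_dartK.
Qed.

Lemma dart_potential (H : groupType) (h : nat -> H) :
  {in F, forall x, h (al x) = (h x)^-1%g} ->
  {in fs, forall s, holonomy h s = 1%g} ->
  exists f, {in F, forall x, f (al x) = (f x * h x)%g} /\
            {in F, forall x, f (next_dart fs x) = (f x * h x)%g}.
Proof.
move=> hal hfs; have [f [fal fp]] := dg_sc dg hal hfs; exists f; split=> // x xF.
have [ff xf] := face_mem xF; have [c pc] := fp _ ff.
by apply: potential_next pc _ => //; [exact: (uniq_flatten_mem uF)|exact: hfs].
Qed.

Let D : finType := seq_sub F.
Let mkD x (xF : x \in F) : D := SeqSub xF.

Let sg_fun (d : D) : D := mkD (turn_mem (ssvalP d)).
Let sg_inj : injective sg_fun.
Proof. by move=> d1 d2 /(congr1 val) /= /turn_inj e; apply/val_inj/e; exact: ssvalP. Qed.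
Let sg : {perm D} := perm sg_inj.
Let valsg d : val (sg d) = turn (val d).
Proof. by rewrite permE. Qed.

Let al_D (d : D) : D := mkD (dg_mem dg (ssvalP d)).

Let bigD (V : Type) (idx : V) (op : Monoid.com_law idx) (G : nat -> V) (Q : pred nat) :
  \big[op/idx]_(d : D | Q (val d)) G (val d) = \big[op/idx]_(x <- F | Q x) G x.
Proof.
rewrite -(big_map val Q G) /=; apply: perm_big; apply: uniq_perm => //.
  by rewrite map_inj_uniq ?index_enum_uniq //; exact: val_inj.
move=> x; apply/mapP/idP => [[d _ ->]|xF]; first exact: ssvalP.
by exists (mkD xF); rewrite // mem_index_enum.
Qed.

(** V - E + F >= 2, multiplied by 6, with the number of vertices estimated by
    [card_porbits_ge3]: each corner at a vertex of degree at least 3 costs 1. The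
    hypothesis on [next_dart] excludes vertices of degree 1. *)
Lemma diagram_euler : fs != [::] -> [::] \notin fs ->
  {in F, forall x, next_dart fs x != al x} ->
  12 + count branch F <= 6 * size fs.
Proof.
move=> fs0 nonil nospike.
have D_gt0 : 0 < #|D|.
  have [x xF] : exists x : nat, x \in F.
    rewrite /F; case: (fs) fs0 nonil => // -[|x s] fs1 _; first by rewrite in_cons eqxx.
    by exists x; rewrite in_cons eqxx.
  by apply/card_gt0P; exists (mkD xF).
have fsz (d : D) : index (face fs (val d)) fs < size fs.
  by rewrite index_mem; exact: (face_mem (ssvalP d)).1.
pose fc d : 'I_(size fs) := Ordinal (fsz d).
have half_al (d : D) : val (al_D d) < al (val (al_D d)) = ~~ (val d < al (val d)).
  rewrite /= (dg_invol dg) ?ssvalP // -leqNgt ltn_neqAle.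
  case: eqP => // e; have := dg_lab dg (ssvalP d); rewrite e => /esym/eqP.
  by rewrite (negPf (inv_letter_neq _)).
have al_DK : involutive al_D by move=> d; apply: val_inj; rewrite /= (dg_invol dg) ?ssvalP.
have := @euler_F2 D 'I_(size fs) al_D sg fc (fun d => val d < al (val d)) al_DK half_al D_gt0.
rewrite card_ord => euler.
have {euler} euler : #|D| + 4 <= 2 * #|porbits sg| + 2 * size fs.
  apply: euler => h hal hfc.
  pose h' x : 'F_2 := if insub x is Some d then h d else 0%R.
  have hv (d : D) : h' (val d) = h d by rewrite /h' valK.
  have hol_sum s : (holonomy h' s = \sum_(x <- s) h' x)%R.
    by elim: s => [|x s IH]; rewrite ?big_nil // big_cons /= IH.
  have [||f [fal fnx]] := @dart_potential 'F_2 h'.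
  - move=> x xF; rewrite -[al x]/(val (al_D (mkD xF))) -[x]/(val (mkD xF)) !hv /=.
    change (h (al_D (mkD xF)) = - h (mkD xF))%R.
    by rewrite hal; apply/eqP; rewrite -addr_eq0 addF2.
  - move=> s sin; rewrite hol_sum.
    have sz : index s fs < size fs by rewrite index_mem.
    have <- : (\sum_(d : D | val d \in s) h' (val d) = 1%g)%R.
      rewrite -[RHS](hfc (Ordinal sz)); apply: eq_big => d; last by rewrite hv.
      have [ff df] := face_mem (ssvalP d).
      apply/idP/eqP => [ds|/(congr1 val)/= e].
        by apply: val_inj; rewrite /= (face_eq uF sin ds).
      by rewrite -(nth_index [::] sin) -e nth_index.
    rewrite (bigD _ h' (mem s)) -big_filter; apply: perm_big; apply: uniq_perm.
    - exact: uniq_flatten_mem sin.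
    - exact: filter_uniq.
    move=> x; rewrite mem_filter; apply/idP/andP => [xs|[] //]; split=> //.
    by apply/flattenP; exists s.
  exists (fun d => f (val d)); split=> d.
    have dF := ssvalP d; have [_ pF] := face_prev_dart dF.
    by rewrite valsg fal // -fnx // prev_dartK.
  have -> : val (al_D d) = al (val d) by [].
  rewrite fal ?ssvalP // hv.
  change (h d = f (val d) + h d + f (val d))%R.
  by rewrite addrAC addF2 add0r.
have nofix d : sg d != d.
  apply/eqP=> /(congr1 val); rewrite valsg /turn => e.
  have xF := ssvalP d; have [_ pF] := face_prev_dart xF.
  by have := nospike _ pF; rewrite prev_dartK // e eqxx.
have := card_porbits_ge3 nofix.
have -> : \sum_(d : D) (sg (sg d) != d) = count branch F.
  rewrite -sum1_count [RHS]big_mkcond /=.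
  rewrite -(bigD _ (fun x => if branch x then 1 else 0) predT) /=; apply: eq_bigr => d _.
  by rewrite /branch -!valsg (inj_eq val_inj); case: (_ != _).
lia.
Qed.

End DiagramEuler.

(** * Geodesic words and cyclic sequences *)

Section EvalWord.
Variables (S : finType) (G : groupType) (gen : S -> G).
Implicit Types (u v w q : word S) (a : letter S).

Lemma eval_inv_letter a : eval_letter gen (inv_letter a) = (eval_letter gen a)^-1%g.
Proof. by case: a => s [] //=; rewrite /eval_letter /= invgK. Qed.

Lemma eval_word_cat u v : eval_word gen (u ++ v) = (eval_word gen u * eval_word gen v)%g.
Proof. by elim: u => [|a u IH] /=; rewrite ?mul1g // IH mulgA. Qed.

Lemma eval_inv_word w : eval_word gen (inv_word w) = (eval_word gen w)^-1%g.
Proof.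
elim: w => [|a w IH]; first by rewrite /= invg1.
by rewrite inv_word_cons -cats1 eval_word_cat IH /= mulg1 eval_inv_letter invMg.
Qed.

Lemma eval_word_holonomy (lab : nat -> letter S) s :
  eval_word gen (map lab s) = holonomy (fun x => eval_letter gen (lab x)) s.
Proof. by elim: s => //= x s ->. Qed.

Definition geodesic w : Prop :=
  forall w', eval_word gen w' = eval_word gen w -> size w <= size w'.

Lemma geodesic_sub u v w : geodesic (u ++ v ++ w) -> geodesic v.
Proof.
move=> gd v' e; have := gd (u ++ v' ++ w).
by rewrite !eval_word_cat e !size_cat => /(_ erefl); lia.
Qed.

End EvalWord.

Lemma rot_index_head (T : eqType) (s s' : seq T) i y :
  uniq s -> rot i s = y :: s' -> rot i s = rot (index y s) s.
Proof.
move=> us; case: (ltnP i (size s)) => si e; last first.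
  by rewrite rot_oversize // in e *; rewrite e /= eqxx rot0.
suff -> : index y s = i by [].
have <- : nth y s i = y.
  by rewrite -[i in nth y s i]addn0 -nth_drop; move: e; rewrite /rot (drop_nth y) //= => -[->].
exact: index_uniq.
Qed.

Lemma rot_index_next (T : eqType) (s : seq T) x : uniq s -> x \in s ->
  rot (index (next s x) s) s = rot 1 (rot (index x s) s).
Proof.
move=> us xs; have := rot_index xs; set s' := (_ ++ _) => e.
rewrite e rot1_cons -(next_rot (index x s) us) e next_head.
have [y [s'' e'']] : exists y s'', rcons s' x = y :: s''.
  by case: (s') => [|y s1] /=; [exists x, [::]|exists y, (rcons s1 x)].
have -> : head x s' = y by case: (s') e'' => [|z s1] /= [].
have e2 : rot (index x s + 1) s = y :: s''.
  case: (ltnP (index x s) (size s)); last by rewrite leqNgt index_mem xs.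
  by move=> lt; rewrite addn1 (rotS lt) e rot1_cons.
by rewrite e'' -e2 [RHS](rot_index_head us e2).
Qed.

Lemma iter_rot1 (T : Type) (s : seq T) i : i <= size s -> iter i (rot 1) s = rot i s.
Proof.
elim: i => [|i IH] le; first by rewrite rot0.
by rewrite iterS IH ?(ltnW le) // (rotS le).
Qed.

Lemma nth_iter_rot1 (T : Type) (x0 : T) (s : seq T) i c x : i < size s ->
  iter i (rot 1) s = x :: c -> nth x0 s i = x.
Proof.
move=> lt; rewrite iter_rot1 ?(ltnW lt) // /rot (drop_nth x0) //=.
by case.
Qed.

Lemma first_has (T : Type) (P : pred T) s : has P s ->
  exists A z R, [/\ s = A ++ z :: R, P z & count P A = 0].
Proof.
elim: s => //= x s IH; case Px: (P x) => /=.
  by move=> _; exists [::], x, s.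
by move=> /IH[A [z [R [-> Pz cA]]]]; exists (x :: A), z, R; split; rewrite //= Px cA.
Qed.

(** Isolates the part of a geodesic side between the first and the last of its darts
    on a given cell. *)
Lemma span_has (T : Type) (P : pred T) s : has P s ->
  exists A M z1 M1 z2 M2 C, [/\ s = A ++ M ++ C, M = z1 :: M1, M = rcons M2 z2,
    P z1 /\ P z2 & count P s <= size M].
Proof.
move=> /first_has[A [z1 [R [-> Pz1 cA]]]].
have : has P (rev (z1 :: R)) by rewrite has_rev /= Pz1.
move=> /first_has[C [z2 [R2 [e Pz2 cC]]]].
have e1 : z1 :: R = rev R2 ++ z2 :: rev C.
  by rewrite -[LHS]revK e rev_cat rev_cons cat_rcons.
have [M1 eM] : exists M1, rcons (rev R2) z2 = z1 :: M1.
  by case: (rev R2) e1 => [|y l] /= [-> _]; [exists [::]|exists (rcons l z2)].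
exists A, (z1 :: M1), z1, M1, z2, (rev R2), (rev C); split=> //.
  by rewrite -eM e1 cat_rcons.
rewrite count_cat cA e1 -cat_rcons eM count_cat count_rev cC addn0.
exact: count_size.
Qed.

(** * Curvature of a reduced diagram *)

Lemma next_cat (T : eqType) (A B : seq T) x y :
  uniq (A ++ x :: y :: B) -> next (A ++ x :: y :: B) x = y.
Proof. by move=> u; rewrite -(next_rot (size A) u) rot_size_cat /= eqxx. Qed.

Lemma count_split (T : Type) (P Q : pred T) s :
  count P s = count (fun x => P x && Q x) s + count (fun x => P x && ~~ Q x) s.
Proof. by elim: s => //= x s ->; case: (P x); case: (Q x) => /=; lia. Qed.

Lemma iter_nextE (T : eqType) (s : seq T) x y :
  uniq s -> y \in s -> x \in s -> exists k, x = iter k (next s) y.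
Proof.
move=> us ys; have [i s' e] := rot_to ys.
have : fcycle (next s) (rot i s) by rewrite rot_cycle cycle_next.
rewrite -(mem_rot i) e /= rcons_path in_cons => /andP[/fpathP[n ->] _].
case/orP=> [/eqP->|/trajectP[j _ ->]]; first by exists 0.
by exists j.+1; rewrite iterSr.
Qed.

Lemma count_or_and (T : Type) (P Q N : pred T) s :
  count (fun x => (P x || Q x) && N x) s <=
  count (fun x => P x && N x) s + count (fun x => Q x && N x) s.
Proof. by elim: s => //= x s; case: (P x); case: (Q x); case: (N x) => /=; lia. Qed.

(** The situation excluded in this section is a diagram whose outer face consists
    of a side [sp], labelled by a prefix of the relator [t], and of a side [sq]
    labelled by a geodesic word, where no cancellation is possible. *)
Section Curvature.
Variables (S : finType) (G : groupType) (gen : S -> G) (Rel : set (word S)).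
Hypothesis sym_neq0 : forall w, symmetrized Rel w -> w <> [::].
Hypothesis sym_eval : forall w, symmetrized Rel w -> eval_word gen w = 1%g.
Hypothesis sym_reduced : forall w, symmetrized Rel w -> cyclically_reduced w.
Hypothesis small6 : forall r r' p : word S,
  symmetrized Rel r -> symmetrized Rel r' -> r <> r' ->
  prefix p r -> prefix p r' -> 6 * size p < minn (size r) (size r').

Variables (fs : seq (seq nat)) (al : nat -> nat) (lab : nat -> letter S).
Variables (sp sq : seq nat) (hh : word S).
Let s0 := sp ++ sq.
Let FS := s0 :: fs.
Let F := flatten FS.
Let t := map lab sp ++ hh.
Hypothesis dg : diagram FS al lab.
Hypothesis inner_sym : forall s, s \in fs -> symmetrized Rel (map lab s).
Hypothesis sym_t : symmetrized Rel t.
Hypothesis geo_q : geodesic gen (map lab sq).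
Hypothesis eval_s0 : eval_word gen (map lab s0) = 1%g.
Hypothesis s0_neq0 : s0 <> [::].
Hypothesis s0_reduced : {in s0, forall x, lab (next s0 x) != inv_letter (lab x)}.

(** The relator which carries the dart [x], read from [x] on. Darts of the side
    [sp] are treated as if the relator [t] were a cell glued to the diagram from
    outside; the value is meaningless on [sq]. *)
Definition face_word x : word S :=
  if x \in sp then rot (index x sp) t
  else map lab (rot (index x (face FS x)) (face FS x)).
(** The relator which carries [x], read backwards from the opposite of [x]. *)
Definition mirror x : word S := rotr 1 (inv_word (face_word x)).

Hypothesis unaligned : forall y, y \in flatten fs -> al y \notin sq ->
  face_word y <> mirror (al y).

Let uF : uniq F := dg_uniq dg.
Let us0 : uniq s0. Proof. by move: uF; rewrite /F /= cat_uniq => /andP[]. Qed.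
Let usp : uniq sp. Proof. by move: us0; rewrite cat_uniq => /andP[]. Qed.
Let s0FS : s0 \in FS. Proof. exact: mem_head. Qed.
Let s0F x : x \in s0 -> x \in F. Proof. by move=> xs; apply/flattenP; exists s0. Qed.
Let innerF x : x \in flatten fs -> x \in F.
Proof. by move=> xs; rewrite /F /= mem_cat xs orbT. Qed.
Let FP x : x \in F -> [\/ x \in sp, x \in sq | x \in flatten fs].
Proof.
by rewrite /F /s0 /= !mem_cat => /orP[/orP[?|?]|?]; [constructor 1|constructor 2|constructor 3].
Qed.
Let not_sp x : x \in flatten fs -> x \notin s0.
Proof.
move=> xs; move: uF; rewrite /F /= cat_uniq => /and3P[_ /hasP dis _].
by apply/negP => xs0; case: dis; exists x.
Qed.
Let inner_nsp x : x \in flatten fs -> (x \in sp) = false.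
Proof. by move=> /not_sp; rewrite mem_cat negb_or => /andP[/negPf]. Qed.
Let sq_nsp x : x \in sq -> (x \in sp) = false.
Proof.
move=> xs; move: us0; rewrite cat_uniq => /and3P[_ /hasP dis _].
by apply/negP => xs0; case: dis; exists x.
Qed.

Let inner_face x : x \in flatten fs -> face FS x \in fs /\ x \in face FS x.
Proof.
by move=> /flattenP[s sin xs]; rewrite (face_eq uF _ xs) // in_cons sin orbT.
Qed.

Lemma face_word_sp s1 x s2 : sp = s1 ++ x :: s2 ->
  face_word x = lab x :: map lab s2 ++ hh ++ map lab s1.
Proof.
move=> e; have xs : x \in sp by rewrite e mem_cat mem_head orbT.
have ux : x \notin s1.
  by move: usp; rewrite e cat_uniq => /and3P[_ /hasPn/(_ x (mem_head _ _))].
rewrite /face_word xs e index_cat (negPf ux) /= eqxx addn0.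
rewrite /t e map_cat -catA -(size_map lab) rot_size_cat /=.
by rewrite catA.
Qed.

Lemma face_word_inner x : x \in flatten fs ->
  face_word x = map lab (rot (index x (face FS x)) (face FS x)).
Proof. by move=> xs; rewrite /face_word inner_nsp. Qed.

Lemma face_word_sym x : x \in F -> x \notin sq -> symmetrized Rel (face_word x).
Proof.
move=> /FP[xs|->//|xs] _; last first.
  by rewrite face_word_inner // map_rot; apply/symmetrized_rot/inner_sym; exact: (inner_face xs).1.
by rewrite /face_word xs; exact: symmetrized_rot.
Qed.

Lemma face_word_head x : x \in F -> x \notin sq -> exists c, face_word x = lab x :: c.
Proof.
move=> /FP[xs|->//|xs] _; last first.
  by rewrite face_word_inner // rot_index ?(inner_face xs).2 //=; eexists.
by case/splitPr e: _ / xs => [s1 s2]; rewrite (face_word_sp e); eexists.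
Qed.

(** The darts that end at one of the two corners of the outer face. *)
Definition junction x :=
  ((sp != [::]) && (x == last 0 sp)) || ((sq != [::]) && (x == last 0 sq)).

Lemma face_word_next x : x \in F -> x \notin sq -> ~~ junction x ->
  next_dart FS x \in F /\ next_dart FS x \notin sq /\ face_word (next_dart FS x) = rot 1 (face_word x).
Proof.
move=> xF xq; rewrite negb_or !negb_and !negbK => /andP[jp _].
have [nf nF] := face_next_dart dg xF.
case: (FP xF) => [xs|xs|xs]; last 1 first.
- have [fi xf] := inner_face xs.
  have nfs : next_dart FS x \in flatten fs.
    by apply/flattenP; exists (face FS x); rewrite // mem_next.
  split=> //; split.
    by apply: contra (not_sp nfs); rewrite /s0 mem_cat => ->; rewrite orbT.
  rewrite !face_word_inner // nf rot_index_next ?map_rot //.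
  by apply: (uniq_flatten_mem uF); rewrite in_cons fi orbT.
- have xs0 : x \in s0 by rewrite mem_cat xs.
  have -> : next_dart FS x = next s0 x by rewrite /next_dart (face_eq uF s0FS xs0).
  have [s1 [s2 e]] : exists s1 s2, sp = s1 ++ x :: s2.
    by case/splitPr: xs => s1 s2; exists s1, s2.
  case: s2 e => [|y s2] e.
    by move: jp; rewrite e last_cat /= eqxx -size_eq0 size_cat /= addnS.
  have -> : next s0 x = y.
    by move: us0; rewrite /s0 e -catA; exact: next_cat.
  have ys : y \in sp by rewrite e mem_cat !in_cons eqxx !orbT.
  split; first by apply: s0F; rewrite mem_cat ys.
  split; first by apply/negP => /sq_nsp; rewrite ys.
  rewrite (face_word_sp e) (@face_word_sp (rcons s1 x) y s2) ?cat_rcons //.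
  by rewrite rot1_cons map_rcons /= -!cats1 -!catA.
by rewrite xs in xq.
Qed.

Lemma sq_next x : x \in sq -> ~~ junction x -> next_dart FS x \in sq.
Proof.
move=> xs; rewrite negb_or !negb_and !negbK => /andP[_ jp].
have xs0 : x \in s0 by rewrite mem_cat xs orbT.
have -> : next_dart FS x = next s0 x by rewrite /next_dart (face_eq uF s0FS xs0).
have [s1 [s2 e]] : exists s1 s2, sq = s1 ++ x :: s2.
  by case/splitPr: xs => s1 s2; exists s1, s2.
case: s2 e => [|y s2] e.
  by move: jp; rewrite e last_cat /= eqxx -size_eq0 size_cat /= addnS.
have -> : next s0 x = y.
  by move: us0; rewrite /s0 e catA; exact: next_cat.
by rewrite e mem_cat !in_cons eqxx !orbT.
Qed.

Let isq x := al x \in sq.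
Let br x := branch FS al x.
Let brk x := br x || junction (al x).

Let alF x : x \in F -> al x \in F := dg_mem dg (x := x).

(** At a vertex of degree 2 the other side of the edge also continues straight. *)
Lemma nonbranch_step x : x \in F -> ~~ br x -> next_dart FS (al x) = al (prev_dart FS x).
Proof.
move=> xF; rewrite negbK => /eqP; rewrite /turn.
have [_ pF] := face_prev_dart dg xF; move: (alF pF) => aF.
have [_ paF] := face_prev_dart dg aF.
move=> /(congr1 al); rewrite (dg_invol dg) // => e.
by rewrite -e (prev_dartK dg).
Qed.

Lemma unbroken_isq x : x \in F -> ~~ brk x -> isq (prev_dart FS x) = isq x.
Proof.
move=> xF; rewrite negb_or => /andP[nb nj]; rewrite /isq -nonbranch_step //.
apply/idP/idP => [|xs]; last exact: sq_next.
apply: contraTT => xq.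
by have [_ []] := face_word_next (alF xF) xq nj.
Qed.

Lemma unbroken_face_word x : x \in flatten fs -> ~~ brk x -> ~~ isq x ->
  face_word x = rot 1 (face_word (prev_dart FS x)) /\
  mirror (al x) = rot 1 (mirror (al (prev_dart FS x))).
Proof.
move=> xs; rewrite negb_or => /andP[nb nj] xq; have xF := innerF xs.
have [_ [_ e]] := face_word_next (alF xF) xq nj.
rewrite /mirror -nonbranch_step // e inv_word_rot1 rotrK; split=> //.
have [fi xf] := inner_face xs.
have [fp pF] := face_prev_dart dg xF.
have pfs : prev_dart FS x \in flatten fs.
  by apply/flattenP; exists (face FS x); rewrite // mem_prev.
rewrite !face_word_inner // -map_rot fp -rot_index_next ?mem_prev //; last first.
  by apply: (uniq_flatten_mem uF); rewrite in_cons fi orbT.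
by congr (map lab (rot (index _ _) _)); rewrite -{1}(prev_dartK dg xF) /next_dart fp.
Qed.

Let inner_iter (s : seq nat) i y : s \in fs -> y \in s -> iter i (next_dart FS) y \in s /\
  iter i (prev_dart FS) y \in s.
Proof.
move=> sin ys; have sFS : s \in FS by rewrite in_cons sin orbT.
have mn x : x \in s -> next_dart FS x \in s by move=> xs; rewrite /next_dart (face_eq uF sFS) // mem_next.
have mp x : x \in s -> prev_dart FS x \in s by move=> xs; rewrite /prev_dart (face_eq uF sFS) // mem_prev.
by elim: i => [|i [/mn ? /mp ?]].
Qed.

(** A stretch of a cell along which nothing breaks has a single relator on its
    other side, so its label is a common prefix of two elements of the symmetrized
    set; these are different because no edge is aligned. *)
Lemma piece_short (s : seq nat) y m : s \in fs -> y \in s -> m < size s ->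
  ~~ isq y ->
  (forall i, 0 < i <= m -> ~~ brk (iter i (next_dart FS) y)) -> 6 * m.+1 < size s.
Proof.
move=> sin ys ms yq nb.
have memi i : iter i (next_dart FS) y \in flatten fs.
  by apply/flattenP; exists s => //; exact: (inner_iter i sin ys).1.
have run i : i <= m -> [/\ ~~ isq (iter i (next_dart FS) y),
    face_word (iter i (next_dart FS) y) = iter i (rot 1) (face_word y) &
    mirror (al (iter i (next_dart FS) y)) = iter i (rot 1) (mirror (al y))].
  elim: i => [|i IH] im //; have [nq ew em] := IH (ltnW im).
  have pe : prev_dart FS (iter i.+1 (next_dart FS) y) = iter i (next_dart FS) y.
    by rewrite iterS (next_dartK dg) // innerF.
  have nbi : ~~ brk (iter i.+1 (next_dart FS) y) by apply: nb.
  have nqi : ~~ isq (iter i.+1 (next_dart FS) y).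
    by rewrite -(unbroken_isq (innerF (memi _)) nbi) pe.
  have [e1 e2] := unbroken_face_word (memi _) nbi nqi.
  by split=> //; rewrite ?e1 ?e2 pe ?ew ?em.
have szr : size (face_word y) = size s.
  rewrite face_word_inner ?(memi 0) // size_map size_rot (@face_eq FS s) //.
  by rewrite in_cons sin orbT.
have yF := innerF (memi 0).
have symy : symmetrized Rel (face_word y).
  by apply: face_word_sym => //; have := not_sp (memi 0); rewrite mem_cat negb_or => /andP[].
have symm : symmetrized Rel (mirror (al y)).
  have sy := face_word_sym (alF yF) yq.
  by rewrite /mirror /rotr; apply/symmetrized_rot/symmetrized_inv.
have [a _] : exists a : letter S, True by exists (lab y).
pose j := minn m.+1 (minn (size (face_word y)) (size (mirror (al y)))).
have jm : j <= m.+1 by exact: geq_minl.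
have jr : j <= size (face_word y) by rewrite /j (leq_trans (geq_minr _ _)) ?geq_minl.
have jl : j <= size (mirror (al y)) by rewrite /j (leq_trans (geq_minr _ _)) ?geq_minr.
have eqt : take j (face_word y) = take j (mirror (al y)).
  apply: (@eq_from_nth _ a); first by rewrite !size_takel.
  move=> i; rewrite size_takel // => ij.
  rewrite !nth_take //.
  have im : i <= m by rewrite -ltnS (leq_trans ij jm).
  have [nq ew em] := run i im.
  have zF := innerF (memi i); set z := iter i _ y in nq ew em zF.
  have zq : z \notin sq.
    by have := not_sp (memi i); rewrite mem_cat negb_or => /andP[].
  have [c1 e1] := face_word_head zF zq.
  have [c2 e2] := face_word_head (alF zF) nq.
  have e3 : mirror (al z) = lab z :: inv_word c2.
    by rewrite /mirror e2 inv_word_cons rotr1_rcons (dg_lab dg) // inv_letterK.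
  rewrite (@nth_iter_rot1 _ a (face_word y) i c1 (lab z)) -?ew //; last exact: leq_trans ij jr.
  rewrite (@nth_iter_rot1 _ a (mirror (al y)) i (inv_word c2) (lab z)) -?em //; exact: leq_trans ij jl.
have := @small6 _ _ (take j (face_word y)) symy symm (unaligned (memi 0) yq).
rewrite {2}eqt !prefix_take => /(_ isT isT).
rewrite size_takel // /j szr; move: ms.
by move: (size s) (size (mirror (al y))); clear; lia.
Qed.

Let nsq x := ~~ isq x.

(** The part of a cell away from [sq] is cut by its breaks into pieces, each of
    them shorter than a sixth of the cell. The predecessor on the right-hand side
    expresses that this inequality is strict. *)
Lemma count_other_sides (s : seq nat) : s \in fs ->
  6 * count nsq s <= (size s).-1 * count (fun x => brk x && nsq x) s.
Proof.
move=> sin; have sFS : s \in FS by rewrite in_cons sin orbT.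
have us := uniq_flatten_mem uF sFS.
have sz0 : 0 < size s.
  by rewrite lt0n size_eq0; apply/eqP => e; apply: (sym_neq0 (inner_sym sin)); rewrite e.
set n := size s in sz0 *; set beta := count (fun x => brk x && nsq x) s.
(* The largest length of a piece of this cell. *)
pose m0 := n.-1 %/ 6.
have m0le : 6 * m0 <= n.-1 by rewrite mulnC leq_trunc_div.
have m0ge : n <= 6 * m0.+1 by have := @ltn_ceil n.-1 6 isT; rewrite -/m0 mulnC; move: sz0; clear; lia.
suff le : count nsq s <= beta * m0.
  have := leq_mul m0le (leqnn beta); move: le.
  by move: (count nsq s); clear; lia.
pose B := [seq x <- s | brk x && nsq x].
rewrite -size_filter /beta -size_filter -/B -[X in _ * X](size_iota 0 m0).
rewrite -(size_allpairs (fun x i => iter i (next_dart FS) x)).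
apply: uniq_leq_size; first exact: filter_uniq.
move=> z; rewrite mem_filter => /andP[zq zs].
have memi i := (inner_iter i sin zs).2.
have inF x : x \in s -> x \in F by move=> xs; apply/flattenP; exists s.
have nx_pv i : next_dart FS (iter i.+1 (prev_dart FS) z) = iter i (prev_dart FS) z.
  by rewrite iterS (prev_dartK dg) // inF.
have iter_back i j : j <= i -> iter j (next_dart FS) (iter i (prev_dart FS) z) = iter (i - j) (prev_dart FS) z.
  elim: j => [|j IH] ji; first by rewrite subn0.
  by rewrite iterS IH ?(ltnW ji) // (_ : i - j = (i - j.+1).+1) ?nx_pv //; move: ji; clear; lia.
have back i : (forall j, j < i -> ~~ brk (iter j (prev_dart FS) z)) ->
    forall j, j <= i -> nsq (iter j (prev_dart FS) z).
  move=> nb; elim=> [|j IH] ji //.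
  rewrite iterS /nsq unbroken_isq ?inF //; last by apply: nb.
  exact: IH (ltnW ji).
have exb : exists i, (i < m0) && brk (iter i (prev_dart FS) z).
  apply/not_existsP => nb.
  have nb' j : j < m0 -> ~~ brk (iter j (prev_dart FS) z).
    by move=> jm; have := nb j; rewrite jm => /negP.
  have y_nsq := back m0 nb' m0 (leqnn _).
  have mn : m0 < size s by move: m0le sz0; clear; rewrite -/n; lia.
  have nb2 j : 0 < j <= m0 -> ~~ brk (iter j (next_dart FS) (iter m0 (prev_dart FS) z)).
    by move=> /andP[j0 jm]; rewrite iter_back //; apply: nb'; move: j0 jm; clear; lia.
  by have := piece_short sin (memi m0) mn y_nsq nb2; move: m0ge; rewrite -/n; clear; lia.
have [i /andP[im bi] mini] := ex_minnP exb.
apply/allpairsP; exists (iter i (prev_dart FS) z, i); split=> /=.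
- rewrite mem_filter memi andbT bi /=; apply: (back i) => // j ji.
  by apply/negP => bj; have := mini j; rewrite bj andbT (ltn_trans ji im) leqNgt ji => /(_ isT).
- by rewrite mem_iota.
- by rewrite iter_back // subnn.
Qed.

(** The first and the last dart of [sq] on the cell [s] span a geodesic at least
    as long as the number of darts of [sq] on [s], and both ends of it lie on [s],
    where they are joined by two arcs whose lengths add up to [size s]. *)
Lemma geodesic_side (s : seq nat) : s \in fs -> 2 * count isq s <= size s.
Proof.
move=> sin; have sFS : s \in FS by rewrite in_cons sin orbT.
have us := uniq_flatten_mem uF sFS.
have inF x : x \in s -> x \in F by move=> xs; apply/flattenP; exists s.
have sqF x : x \in sq -> x \in F by move=> xs; apply: s0F; rewrite mem_cat xs orbT.
case: (ltnP 0 (count isq s)) => [c0|]; last by case: count.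
pose Q z := al z \in s.
have cQ : count isq s <= count Q sq.
  rewrite -!size_filter -(size_map al); apply: uniq_leq_size.
    rewrite map_inj_in_uniq ?filter_uniq // => x y.
    rewrite !mem_filter => /andP[_ /inF xF] /andP[_ /inF yF] /(congr1 al).
    by rewrite !(dg_invol dg).
  move=> z /mapP[x]; rewrite mem_filter => /andP[xq xs] ->.
  by rewrite mem_filter /Q (dg_invol dg) ?inF // xs; exact: xq.
have hQ : has Q sq by rewrite has_count; apply: leq_trans cQ.
have [A [M [z1 [M1 [z2 [M2 [C [eq_sq eM1 eM2 [Q1 Q2] cM]]]]]]]] := span_has hQ.
pose ev x := eval_letter gen (lab x).
have [||f [fal fpot]] := dg_sc dg (h := ev).
- by move=> x xF; rewrite /ev (dg_lab dg) // eval_inv_letter.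
- move=> s'; rewrite in_cons -(eval_word_holonomy gen lab) => /orP[/eqP->//|sin'].
  exact/sym_eval/inner_sym.
have zM z : z \in M -> z \in F.
  by move=> zM; apply: sqF; rewrite eq_sq !mem_cat zM orbT.
have z1F : z1 \in F by apply: zM; rewrite eM1 mem_head.
have z2F : z2 \in F by apply: zM; rewrite eM2 mem_rcons mem_head.
have fM : (f z2 * ev z2 = f z1 * eval_word gen (map lab M))%g.
  have [c] := fpot _ s0FS.
  rewrite /s0 eq_sq potential_cat => -[_]; rewrite potential_cat => -[_].
  rewrite potential_cat => -[pM _]; move: pM; set c' := (_ * _)%g => pM.
  have f1 : f z1 = c' by move: pM; rewrite eM1 => -[].
  move: pM; rewrite (eval_word_holonomy gen lab) eM2 -cats1 potential_cat => -[_ [f2 _]].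
  by rewrite f1 f2 holonomy_cat /= mulg1 mulgA.
have [hs ps] : holonomy ev s = 1%g /\ exists c, potential f ev c s.
  split; last by apply: fpot.
  by rewrite -(eval_word_holonomy gen lab); apply/sym_eval/inner_sym.
have [c pc] := ps.
have [i s' es] := rot_to Q2.
have [hr [c' pr]] := potential_rot i hs pc.
have [A' [B' eAB]] : exists A' B', rot i s = A' ++ al z1 :: B'.
  have : al z1 \in rot i s by rewrite mem_rot.
  by case/splitPr => A' B'; exists A', B'.
have f2 : f (al z2) = c' by move: pr; rewrite es => -[].
move: hr pr; rewrite eAB holonomy_cat potential_cat /= => hr [_ [f1 _]].
have fz1 : f z1 = (c' * holonomy ev A' * ev (al z1))%g.
  by rewrite -f1 -fal ?alF // (dg_invol dg).
have eM : (holonomy ev A' * ev (al z1) * eval_word gen (map lab M) = 1)%g.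
  apply: (mulgI c'); rewrite mulg1 !mulgA -fz1 -fM -f2.
  by rewrite fal.
have eMB : eval_word gen (map lab B') = eval_word gen (map lab M).
  rewrite (eval_word_holonomy gen lab); apply: (mulgI (holonomy ev A' * ev (al z1))%g).
  by rewrite eM -mulgA.
have eMA : eval_word gen (inv_word (map lab (rcons A' (al z1)))) = eval_word gen (map lab M).
  rewrite eval_inv_word -eMB (eval_word_holonomy gen lab) -cats1 holonomy_cat /= mulg1.
  rewrite (eval_word_holonomy gen lab); apply: (mulgI (holonomy ev A' * ev (al z1))%g).
  by rewrite mulgV -mulgA.
have gM : geodesic gen (map lab M).
  by apply: (@geodesic_sub _ _ _ (map lab A) _ (map lab C)); rewrite -!map_cat -eq_sq.
have := gM _ eMB; have := gM _ eMA; rewrite size_inv_word !size_map size_rcons.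
have -> : size s = size A' + (size B').+1 by rewrite -(size_rot i) eAB size_cat.
move: (leq_trans cQ cM); clear; lia.
Qed.

(** The breaks away from [sq] are at least 4 if [s] touches [sq], and then there is
    also a break where [s] starts to touch [sq]; they are at least 7 if it does
    not. *)
Lemma interior_curvature (s : seq nat) : s \in fs ->
  6 <= count br s + count (fun x => br x && isq x) s + 2 * count (fun x => junction (al x)) s.
Proof.
move=> sin; have sFS : s \in FS by rewrite in_cons sin orbT.
have us := uniq_flatten_mem uF sFS.
have inF x : x \in s -> x \in F by move=> xs; apply/flattenP; exists s.
have sz0 : 0 < size s.
  by rewrite lt0n size_eq0; apply/eqP => e; apply: (sym_neq0 (inner_sym sin)); rewrite e.
have := count_other_sides sin; have := geodesic_side sin.
have eqN : size s = count isq s + count nsq s.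
  by rewrite -(count_predC isq s).
have le_beta : count (fun x => brk x && nsq x) s <=
    count (fun x => br x && nsq x) s + count (fun x => junction (al x) && nsq x) s.
  exact: count_or_and.
have eqb := count_split br isq s.
have eqj := count_split (fun x => junction (al x)) isq s.
have qbreak : 0 < count isq s -> 2 * count isq s <= size s ->
    0 < count (fun x => br x && isq x) s + count (fun x => junction (al x) && isq x) s.
  move=> q0 qn; rewrite lt0n addn_eq0; apply/negP => /andP[/eqP nb /eqP nj].
  have nbrk x : x \in s -> isq x -> isq (prev_dart FS x).
    move=> xs xq; rewrite unbroken_isq ?inF //; apply/negP => /orP[bx|jx].
      suff : has (fun x => br x && isq x) s by rewrite has_count nb.
      by apply/hasP; exists x; rewrite // bx.
    suff : has (fun x => junction (al x) && isq x) s by rewrite has_count nj.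
    by apply/hasP; exists x; rewrite // jx.
  have /hasP[x xs xq] : has isq s by rewrite has_count.
  have /hasP[y ys yq] : has nsq s.
    by rewrite has_count; move: qn eqN sz0; clear; lia.
  have nsq_next z : z \in s -> nsq z -> nsq (next s z).
    move=> zs; apply: contra => /(nbrk _ (_ : next s z \in s)).
    by rewrite mem_next /prev_dart (@face_eq FS s) ?mem_next // prev_next //; apply.
  have [k ekx] := iter_nextE us ys xs.
  have kq i : iter i (next s) y \in s /\ nsq (iter i (next s) y).
    elim: i => [|i [IH1 IH2]] //=; split; first by rewrite mem_next.
    exact: nsq_next.
  by have [_] := kq k; rewrite -ekx /nsq xq.
move=> qn N; rewrite -/nsq in eqb eqj.
set beta := count (fun x => brk x && nsq x) s in le_beta N.
rewrite -[fun x => br x && ~~ isq x]/(fun x => br x && nsq x) in eqb.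
rewrite -[fun x => junction (al x) && ~~ isq x]/(fun x => junction (al x) && nsq x) in eqj.
move: eqN le_beta eqb eqj qbreak qn N sz0.
move: (count br s) (count (fun x => br x && isq x) s) (count (fun x => br x && nsq x) s).
move: (count (fun x => junction (al x)) s) (count (fun x => junction (al x) && isq x) s).
move: (count (fun x => junction (al x) && nsq x) s) (count isq s) (count nsq s) (size s) beta.
clear=> jn q nq n beta j jq b bq bn eqN le_beta eqb eqj qbreak qn N sz0.
have b4 : 4 <= beta.
  by rewrite leqNgt; apply/negP => lt; have := leq_mul (leqnn n.-1) (lt : beta <= 3); lia.
case: (posnP q) => [q0|q0]; last by have := qbreak q0 qn; lia.
have b7 : 7 <= beta; last by lia.
by rewrite leqNgt; apply/negP => lt; have := leq_mul (leqnn n.-1) (lt : beta <= 6); lia.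
Qed.

(** The two darts have the same origin. *)
Lemma branch_across x : x \in F -> br (next_dart FS (al x)) = br x.
Proof.
move=> xF; have yF := (face_next_dart dg (alF xF)).2.
have e : turn FS al (next_dart FS (al x)) = x by rewrite /turn (next_dartK dg) ?alF // (dg_invol dg).
rewrite /br /branch e; set y := next_dart FS (al x) in yF e *.
by rewrite -{3}e (inj_in_eq (turn_inj dg)) // (turn_mem dg).
Qed.

Let sub_count_inner (P : pred nat) (l : seq nat) (f : nat -> nat) :
  {in F &, injective f} -> {in flatten fs, forall x, P x -> f x \in l} ->
  count P (flatten fs) <= size l.
Proof.
move=> inj_f Pl; rewrite -size_filter -(size_map f); apply: uniq_leq_size.
  rewrite map_inj_in_uniq ?filter_uniq //.
    by move: uF; rewrite /F /= cat_uniq => /and3P[].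
  by move=> x y; rewrite !mem_filter => /andP[_ /innerF xF] /andP[_ /innerF yF]; apply: inj_f.
by move=> z /mapP[x]; rewrite mem_filter => /andP[Px xs] ->; apply: Pl.
Qed.

(** Summing [interior_curvature] over the cells: branch corners of cells along
    [sq] correspond to different branch corners of the outer face, and at most two
    darts end at the corners of the outer face, so the left-over in Euler's
    inequality would have to satisfy 6 <= 4. *)
Lemma no_reduced_diagram : False.
Proof.
have al_inj : {in F &, injective al}.
  by move=> x y xF yF /(congr1 al); rewrite !(dg_invol dg).
have nilFS : [::] \notin FS.
  rewrite in_cons negb_or eq_sym; apply/andP; split; first exact/eqP.
  by apply/negP => /inner_sym /sym_neq0.
have nospike : {in F, forall x, next_dart FS x != al x}.
  move=> x xF; apply/eqP => e.
  suff : lab (next_dart FS x) != inv_letter (lab x) by rewrite e (dg_lab dg) // eqxx.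
  have /flattenP[s] := xF; rewrite in_cons => /orP[/eqP->|sin] xs.
    by rewrite /next_dart (@face_eq FS s0) //; exact: s0_reduced.
  have := sym_reduced (inner_sym sin); rewrite /cyclically_reduced cycle_map => cs.
  rewrite /next_dart (@face_eq FS s) ?in_cons ?sin ?orbT //.
  exact: (next_cycle cs xs).
have euler := @diagram_euler _ FS al lab dg isT nilFS nospike.
have inner : forall fs', {subset fs' <= fs} -> 6 * size fs' <= count br (flatten fs') +
    count (fun x => br x && isq x) (flatten fs') +
    2 * count (fun x => junction (al x)) (flatten fs').
  elim=> [|s fs' IH] sub //=.
  have {}IH := IH (fun s' s'in => sub s' (mem_behead (s := s :: fs') s'in)).
  have := interior_curvature (sub s (mem_head _ _)); rewrite !count_cat.
  move: IH (count br s) (count (fun x => br x && isq x) s) (count (fun x => junction (al x)) s).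
  move: (count br (flatten fs')) (count (fun x => br x && isq x) (flatten fs')).
  by move: (count (fun x => junction (al x)) (flatten fs')) (size fs'); clear; lia.
have {inner} := inner fs (fun s' h => h).
have Mq : count (fun x => br x && isq x) (flatten fs) <= count br s0.
  rewrite -(size_filter br); apply: (sub_count_inner (f := fun x => next_dart FS (al x))).
    move=> x y xF yF /(congr1 (prev_dart FS)); rewrite !(next_dartK dg) ?alF //.
    exact: al_inj.
  move=> x /innerF xF /andP[bx qx]; rewrite mem_filter branch_across // bx /=.
  have ax : al x \in s0 by rewrite mem_cat -/(isq x) qx orbT.
  by rewrite /next_dart (@face_eq FS s0) // mem_next.
have J : count (fun x => junction (al x)) (flatten fs) <= 2.
  apply: (@sub_count_inner _ [:: last 0 sp; last 0 sq] al al_inj) => x _.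
  by rewrite !in_cons orbF => /orP[/andP[_ ->]|/andP[_ ->]]; rewrite ?orbT.
move: euler; rewrite -[flatten FS]/(s0 ++ flatten fs) count_cat.
rewrite -[count (branch FS al) s0]/(count br s0) -[count (branch FS al) (flatten fs)]/(count br (flatten fs)).
rewrite -[size FS]/(size fs).+1; move: Mq J.
move: (count br s0) (count br (flatten fs)) (count (fun x => br x && isq x) (flatten fs)).
by move: (count (fun x => junction (al x)) (flatten fs)) (size fs); clear; lia.
Qed.

End Curvature.

(** * Reduced words and removal of mirrored cells *)

Section Reduced.
Variable S : finType.
Implicit Types (u v w : word S) (a b : letter S).

Definition follows a b := b != inv_letter a.

Lemma follows_inv a b : follows (inv_letter b) (inv_letter a) = follows a b.
Proof.
by rewrite /follows inv_letterK eq_sym -(inj_eq (inv_inj (@inv_letterK S))) inv_letterK.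
Qed.

Lemma cyclically_reduced_sorted w : cyclically_reduced w -> sorted follows w.
Proof. by case: w => //= a w; rewrite rcons_path => /andP[]. Qed.

Lemma cyclically_reduced_rot n w : cyclically_reduced (rot n w) = cyclically_reduced w.
Proof. exact: rot_cycle. Qed.

Lemma cyclically_reduced_inv w : cyclically_reduced w -> cyclically_reduced (inv_word w).
Proof.
rewrite /cyclically_reduced /inv_word rev_cycle cycle_map => cw.
apply: sub_cycle cw => a b; rewrite -[_ != _]/(follows a b) -follows_inv.
exact.
Qed.

Lemma not_sorted_follows w : ~~ sorted follows w ->
  exists u a v, w = u ++ [:: a; inv_letter a] ++ v.
Proof.
elim: w => // a [|b w] IH //=; rewrite negb_and => /orP[|/IH[u [c [v ->]]]].
  by rewrite negbK => /eqP->; exists [::], a, w.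
by exists (a :: u), c, v.
Qed.

(** The middle letter would be its own inverse, or the two middle letters would
    cancel. *)
Lemma self_inverse_nil v : sorted follows v -> v = inv_word v -> v = [::].
Proof.
have [n] := ubnP (size v); elim: n v => // n IH [|a v] //= sz.
case/lastP: v sz => [_ _ []/esym/eqP|v b sz so].
  by rewrite (negPf (inv_letter_neq _)).
rewrite inv_word_cons inv_word_rcons -rcons_cons => /rcons_inj[_ ev ea].
move: so sz; rewrite ea => {b ea}.
case: v ev => [_|c v ev so sz]; first by rewrite /= /follows eqxx.
have lt : size (c :: v) < n by move: sz; rewrite /= size_rcons; lia.
suff sv : sorted follows (c :: v) by have := IH _ lt sv ev.
by move/path_sorted: so; rewrite -cats1 => /cat_sorted2[].
Qed.

End Reduced.

Lemma diagram_fold_all (S : finType) (A B : seq nat) fs al (lab : nat -> letter S) :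
  map lab A = inv_word (map lab B) -> diagram ((A ++ B) :: fs) al lab ->
  exists al', diagram fs al' lab.
Proof.
elim: B A al => [|b B IH] A al /=.
  move/(congr1 size); rewrite size_map => /size0nil-> /diagram_drop D0.
  by exists al.
rewrite inv_word_cons; case/lastP: A => [/(congr1 size)|A z]; first by rewrite size_rcons.
rewrite map_rcons => /rcons_inj[eA ez].
rewrite cat_rcons => D0.
have D1 : diagram ((z :: b :: (B ++ A)) :: fs) al lab := diagram_rot (s2 := z :: b :: B) D0.
apply: (IH A (refold al z b)) => //.
by apply: diagram_rot; apply: diagram_fold D1; rewrite ez inv_letterK.
Qed.

Section ReducedWords.
Variables (S : finType) (G : groupType) (gen : S -> G).
Implicit Types (q : word S).

Lemma geodesic_sorted q : geodesic gen q -> sorted (@follows S) q.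
Proof.
move=> gq; apply/contraT => /not_sorted_follows[u [a [v eq]]].
have := gq (u ++ v); rewrite eq !eval_word_cat /= mulg1 eval_inv_letter mulgV mul1g.
by rewrite !size_cat /= => /(_ erefl); lia.
Qed.

(** No cell is glued to itself along mirrored edges: the part of its label between
    these two edges would be its own inverse. *)
Lemma no_self_mirror (u : word S) i : cyclically_reduced u -> 0 < i < size u ->
  u <> rotr 1 (inv_word (rot i u)).
Proof.
move=> cu /andP[i0 isz] e.
have [a [Q eQ]] : exists a Q, drop i u = a :: Q.
  case: (drop i u) (size_drop i u) => [|a Q] /= sz; last by exists a, Q.
  by move: sz isz; clear; lia.
have eu : u = take i u ++ a :: Q by rewrite -eQ cat_take_drop.
have : take i u ++ a :: Q = inv_word (rcons (take i u) a) ++ inv_word Q.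
  rewrite -eu {1}e /rot eQ inv_word_cat inv_word_cons inv_word_rcons -rcons_cat rotr1_rcons.
  by [].
rewrite -cat_rcons => /eqP; rewrite eqseq_cat ?size_inv_word // => /andP[/eqP es _].
have : rcons (take i u) a = [::].
  apply: self_inverse_nil es.
  by have := cyclically_reduced_sorted cu; rewrite {1}eu -cat_rcons => /cat_sorted2[].
by case: (take i u).
Qed.

End ReducedWords.

(** * Geodesics with the same ends as an arc of a relator *)

Lemma diagram_rot_to (S : finType) s s' i fs al (lab : nat -> letter S) :
  rot i s = s' -> diagram (s :: fs) al lab -> diagram (s' :: fs) al lab.
Proof. by move=> <-; rewrite -{1}(cat_take_drop i s); exact: diagram_rot. Qed.

Section Aligned.
Variables (S : finType) (Rel : set (word S)).
Variables (fs : seq (seq nat)) (al : nat -> nat) (lab : nat -> letter S).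
Variables (sp sq : seq nat) (hh : word S).
Hypothesis dg : diagram ((sp ++ sq) :: fs) al lab.
Hypothesis inner_sym : forall s, s \in fs -> symmetrized Rel (map lab s).
Hypothesis sym_reduced : forall w, symmetrized Rel w -> cyclically_reduced w.
Let rw := face_word fs lab sp sq hh.
Let uF := dg_uniq dg.

Let inner_front y : y \in flatten fs -> exists s s',
  [/\ s \in fs, rot (index y s) s = y :: s' & rw y = lab y :: map lab s'].
Proof.
move=> yF; have /flattenP[s sin ys] := yF.
exists s; have e := rot_index ys; eexists; split=> //; first exact: e.
rewrite /rw (face_word_inner _ dg) // (@face_eq _ s) // ?in_cons ?sin ?orbT //.
by rewrite e.
Qed.

(** Erasing an edge between the relator side and a cell which continues that
    relator replaces the prefix [p] of the relator by the rest of the relator, read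
    backwards, up to folding. *)
Lemma aligned_outer y : y \in flatten fs -> al y \in sp ->
  rw y = mirror fs lab sp sq hh (al y) ->
  bounds Rel (size fs).-1 (inv_word hh ++ map lab sq).
Proof.
move=> yF xs; set x := al y in xs *.
have yFS : y \in flatten ((sp ++ sq) :: fs) by rewrite /= mem_cat yF orbT.
have axy : al x = y by rewrite /x (dg_invol dg).
have [s [s' [sin es ey]]] := inner_front yF; rewrite ey.
have [s1 [s2 e]] : exists s1 s2, sp = s1 ++ x :: s2.
  by case/splitPr: xs => s1 s2; exists s1, s2.
rewrite /mirror (face_word_sp _ dg e) inv_word_cons rotr1_rcons => -[_ es'].
have D1 : diagram ((s1 ++ x :: s2 ++ sq) :: fs) al lab.
  by move: dg; rewrite e -catA.
have D2 := diagram_rot D1.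
have D3 : diagram (s :: (x :: (s2 ++ sq) ++ s1) :: rem s fs) al lab.
  apply: diagram_perm D2; rewrite perm_sym (perm_catCA [:: s] [:: _]) /= perm_cons.
  by rewrite perm_sym perm_to_rem.
have D4 : diagram ((x :: (s2 ++ sq) ++ s1) :: (y :: s') :: rem s fs) al lab.
  apply: diagram_perm (diagram_rot_to es D3).
  by rewrite (perm_catCA [:: _] [:: _]).
have D5 := diagram_merge axy D4.
have : bounds Rel (size fs).-1 (map lab (s' ++ (s2 ++ sq) ++ s1)).
  exists (s' ++ (s2 ++ sq) ++ s1), (rem s fs), al, lab; split=> //.
    by rewrite size_rem.
  by move=> s3 /mem_rem; exact: inner_sym.
rewrite !map_cat es' !inv_word_cat -!catA.
set p1 := map lab s1; set p2 := map lab s2; set q := map lab sq => D6.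
have := @bounds_folds _ _ _ (inv_word p1 ++ inv_word hh) (q ++ p1) (inv_word p2).
rewrite inv_wordK -!catA => /(_ Rel _ D6); rewrite !catA => /bounds_rot; rewrite -!catA => D7.
by have := @bounds_folds _ _ _ [::] (inv_word hh ++ q) p1; apply.
Qed.

(** Two different cells which are mirror images across an edge: after erasing the
    edge, the boundary of their union is [w ++ inv_word w] up to rotation, so it
    can be folded completely. *)
Lemma aligned_inner y : y \in flatten fs -> al y \in flatten fs ->
  rw y = mirror fs lab sp sq hh (al y) ->
  bounds Rel (size fs - 2) (map lab (sp ++ sq)).
Proof.
move=> yF xF; set x := al y in xF *.
have yFS : y \in flatten ((sp ++ sq) :: fs) by rewrite /= mem_cat yF orbT.
have axy : al x = y by rewrite /x (dg_invol dg).
have [s [s' [sin es ey]]] := inner_front yF.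
have [r [r' [rin er ex]]] := inner_front xF.
rewrite ey /mirror -/rw ex inv_word_cons rotr1_rcons => -[elab ew].
case: (eqVneq r s) => [ers|nrs].
  have ys : y \in s by rewrite -(mem_rot (index y s)) es mem_head.
  have xs : x \in s by rewrite -ers -(mem_rot (index x r)) er mem_head.
  have xy : x != y by apply/eqP => exy; move/eqP: elab; rewrite exy eq_sym (negPf (inv_letter_neq _)).
  have us : uniq s by apply: (uniq_flatten_mem uF); rewrite in_cons sin orbT.
  set u := rot (index y s) s in es.
  have uu : uniq u by rewrite rot_uniq.
  have xu : x \in u by rewrite mem_rot.
  have eru : rot (index x u) u = x :: r'.
    rewrite -er ers.
    have [k ek] : exists k, rot (index x u) u = rot k s.
      have iu : index x u <= size s by rewrite -(size_rot (index y s) s) index_size.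
      by eexists; rewrite {2}/u rot_add_mod ?index_size.
    by rewrite ek; apply: (@rot_index_head _ s _ k x us); rewrite -ek rot_index.
  case: (@no_self_mirror S (map lab u) (index x u)).
  - apply: sym_reduced; rewrite map_rot; exact/symmetrized_rot/inner_sym.
  - by rewrite size_map index_mem xu andbT lt0n es /= [y == x]eq_sym (negPf xy).
  by rewrite -map_rot eru /= inv_word_cons rotr1_rcons -ew -elab es.
have sr : s \in rem r fs.
  by move: sin; rewrite (perm_mem (perm_to_rem rin)) in_cons eq_sym (negPf nrs).
have szfs : size fs = (size (rem s (rem r fs))).+2.
  by rewrite (perm_size (perm_to_rem rin)) /= (perm_size (perm_to_rem sr)).
have D1 : diagram (r :: s :: (sp ++ sq) :: rem s (rem r fs)) al lab.
  apply: diagram_perm dg; rewrite perm_sym (perm_catCA [:: r; s] [:: _]) /= perm_cons perm_sym.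
  by rewrite (perm_trans (perm_to_rem rin)) // perm_cons perm_to_rem.
have D2 := diagram_rot_to er D1.
have D3 : diagram (s :: (x :: r') :: (sp ++ sq) :: rem s (rem r fs)) al lab.
  by apply: diagram_perm D2; rewrite (perm_catCA [:: _] [:: _]).
have D4 : diagram ((x :: r') :: (y :: s') :: (sp ++ sq) :: rem s (rem r fs)) al lab.
  by apply: diagram_perm (diagram_rot_to es D3); rewrite (perm_catCA [:: _] [:: _]).
have [al' D5] := diagram_fold_all ew (diagram_merge axy D4).
exists (sp ++ sq), (rem s (rem r fs)), al', lab; split=> //.
  by rewrite szfs subSS subSS subn0.
by move=> s3 /mem_rem/mem_rem; exact: inner_sym.
Qed.

End Aligned.

Section SmallCancellation.
Variables (S : finType) (G : groupType) (gen : S -> G) (Rel : set (word S)).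
Implicit Types (p q h w : word S).
Hypothesis sym_neq0 : forall w, symmetrized Rel w -> w <> [::].
Hypothesis sym_eval : forall w, symmetrized Rel w -> eval_word gen w = 1%g.
Hypothesis sym_reduced : forall w, symmetrized Rel w -> cyclically_reduced w.
Hypothesis small6 : forall r r' p : word S,
  symmetrized Rel r -> symmetrized Rel r' -> r <> r' ->
  prefix p r -> prefix p r' -> 6 * size p < minn (size r) (size r').

(** By induction on the number of cells, and then on the length of [p]. The two
    outcomes are symmetric: [aligned_outer] replaces [p] by [inv_word h] and
    exchanges them. *)
Lemma geodesic_of_relator k p h q : symmetrized Rel (p ++ h) -> geodesic gen q ->
  eval_word gen (p ++ q) = 1%g -> bounds Rel k (p ++ q) -> q = inv_word p \/ q = h.
Proof.
have [n] := ubnP k; elim: n k p h q => // n IHk k p h q kn.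
have [m] := ubnP (size p); elim: m p h q => // m IHp p h q sp_m sym_t gq evq Dpq.
have tred := sym_reduced sym_t.
case: p sp_m sym_t tred evq Dpq => [|a p] sp_m sym_t tred evq Dpq.
  by left; have := gq [::]; rewrite [eval_word gen q]evq => /(_ erefl); rewrite leqn0 size_eq0 => /eqP.
have nqq w b c : q <> w ++ [:: b; inv_letter b] ++ c.
  move=> eq; have := gq (w ++ c); rewrite eq !eval_word_cat /= mulg1 eval_inv_letter mulgV mul1g.
  by rewrite !size_cat /= => /(_ erefl); lia.
have geo_drop u v w : q = u ++ v ++ w -> geodesic gen v.
  by move=> e; apply: (@geodesic_sub _ _ gen u v w); rewrite -e.
(* Cancellation where the relator side meets the start of the geodesic. *)
have [[p0 [b [q0 [ep eq]]]]|nA] := pselect (exists p0 b q0, a :: p = rcons p0 b /\ q = inv_letter b :: q0).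
  have eev : eval_word gen (p0 ++ q0) = 1%g.
    rewrite -evq ep eq -cats1 -catA /= !eval_word_cat /= eval_inv_letter mulKVg.
    by [].
  have D0 : bounds Rel k (p0 ++ q0).
    by move: Dpq; rewrite ep eq -cats1 -catA; exact: bounds_fold.
  have := IHp p0 (b :: h) q0 _ _ _ eev D0; rewrite -cat_rcons -ep => IH.
  have [|||e|e] := IH => //.
  - by move: sp_m; rewrite ep size_rcons.
  - by apply: (geo_drop [:: inv_letter b] q0 [::]); rewrite cats0.
  - by left; rewrite eq e ep inv_word_rcons.
  by case: (nqq [::] (inv_letter b) h); rewrite inv_letterK eq e.
(* Cancellation where the end of the geodesic meets the relator side. *)
have [[q0 eq]|nB] := pselect (exists q0, q = rcons q0 (inv_letter a)).
  have eev : eval_word gen (p ++ q0) = 1%g.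
    move: evq; rewrite eq -cats1 /= catA eval_word_cat /= mulg1 eval_inv_letter => e.
    by apply: (mulgI (eval_letter gen a)); apply: (mulIg (eval_letter gen a)^-1%g); rewrite -mulgA e mulg1 mulgV.
  have D0 : bounds Rel k (p ++ q0).
    move: Dpq; rewrite eq -cats1 catA => /bounds_rot/= D1.
    by apply: (@bounds_fold0 _ Rel k (inv_letter a)); rewrite inv_letterK.
  have [|||e|e] := IHp p (rcons h a) q0 _ _ _ eev D0.
  - by move: sp_m.
  - by rewrite -rcons_cat -rot1_cons; apply: symmetrized_rot1.
  - by apply: (geo_drop [::] q0 [:: inv_letter a]); rewrite eq cats1.
  - by left; rewrite eq e inv_word_cons.
  by case: (nqq h a [::]); rewrite eq e -!cats1 -catA.
(* The geodesic is empty, so the relator side is a closed loop, which may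
   cancel with itself. *)
have [[p1 [q0 ep]]|nC] := pselect (exists p1, q = [::] /\ p = rcons p1 (inv_letter a)).
  move=> {nA nB}.
  have eev : eval_word gen (p1 ++ [::]) = 1%g.
    move: evq; rewrite q0 ep !cats0 -cats1 /= eval_word_cat /= mulg1 eval_inv_letter => e.
    by apply: (mulgI (eval_letter gen a)); apply: (mulIg (eval_letter gen a)^-1%g); rewrite -mulgA e mulg1 mulgV.
  have D0 : bounds Rel k (p1 ++ [::]).
    move: Dpq; rewrite q0 ep !cats0 -cats1 -cat1s catA => /bounds_rot/= D1.
    by apply: (@bounds_fold0 _ Rel k (inv_letter a)); rewrite inv_letterK.
  have [|||e|e] := IHp p1 (inv_letter a :: rcons h a) [::] _ _ _ eev D0 => //.
  - by move: sp_m; rewrite ep /= size_rcons; lia.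
  - by move: (symmetrized_rot1 sym_t); rewrite ep /= rot1_cons rcons_cat cat_rcons.
  - have p10 : p1 = [::] by move/(congr1 size): e; rewrite size_inv_word => /esym/size0nil.
    move: tred => /cyclically_reduced_sorted; rewrite ep p10 /= /follows eqxx.
    by [].
have outer_cyc : cyclically_reduced (a :: p ++ q).
  have /cat_sorted2[sp _] := cyclically_reduced_sorted tred.
  rewrite /cyclically_reduced /= rcons_cat cat_path; apply/andP; split; first exact: sp.
  case: q {geo_drop evq Dpq nqq IHp IHk} gq nA nB nC => [|b q] gq nA nB nC /=.
    rewrite andbT; apply/eqP => e; apply: nC.
    case/lastP: p e {nA nB sp sp_m sym_t tred} => [/esym/eqP|p c].
      by rewrite /= (negPf (inv_letter_neq _)).
    by rewrite last_rcons => e; exists p; rewrite e inv_letterK.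
  rewrite rcons_path; apply/and3P; split.
  - apply/eqP => e; apply: nA; exists (belast a p), (last a p), q.
    by rewrite -lastI e.
  - exact: geodesic_sorted gq.
  apply/eqP => e; apply: nB; exists (belast b q).
  by rewrite e inv_letterK -lastI.
have [s0 [fs [al [lab [dg es sz inner]]]]] := Dpq.
have [sp [sq [es0 esp esq]]] := map_eq_cat es.
rewrite es0 in dg es.
have [[y [yF yq ey]]|nal] := pselect (exists y, [/\ y \in flatten fs, al y \notin sq &
    face_word fs lab sp sq h y = mirror fs lab sp sq h (al y)]).
  have k0 : 0 < k.
    by rewrite -sz; case: (fs) yF.
  have : al y \in flatten ((sp ++ sq) :: fs).
    by apply: (dg_mem dg); rewrite /= mem_cat yF orbT.
  rewrite /= !mem_cat (negPf yq) orbF => /orP[ysp|yfs].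
    have := aligned_outer dg inner yF ysp ey; rewrite sz esq => D0.
    have [|||e|e] := IHk k.-1 (inv_word h) (inv_word (a :: p)) q _ _ gq _ D0.
    - by lia.
    - by rewrite -inv_word_cat; apply: symmetrized_inv.
    - have := sym_eval sym_t; rewrite !eval_word_cat eval_inv_word => e1.
      have -> : eval_word gen q = eval_word gen h.
        by apply: (mulgI (eval_word gen (a :: p))); rewrite -eval_word_cat evq e1.
      by rewrite mulVg.
    - by right; rewrite e inv_wordK.
    - by left.
  have := aligned_inner dg inner sym_reduced yF yfs ey; rewrite sz map_cat esp esq => D0.
  by apply: IHk D0 => //; lia.
exfalso.
apply: (@no_reduced_diagram S G gen Rel sym_neq0 sym_eval sym_reduced small6 fs al lab sp sq h) => //.
- by rewrite esp.
- by rewrite esq.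
- by rewrite map_cat esp esq.
- by move=> e; move: esp; case: (sp) e.
- move=> x xs; move: outer_cyc; rewrite -[a :: p ++ q]/((a :: p) ++ q) -esp -esq -map_cat.
  by rewrite /cyclically_reduced cycle_map => /next_cycle; apply.
by move=> y yF yq ey; apply: nal; exists y.
Qed.

End SmallCancellation.

(** * Arcs and midpoints of relators *)

Section Presentation.
Variables (S : finType) (G : groupType) (gen : S -> G) (Rel : set (word S)).
Implicit Types (p q h w r : word S).
Hypothesis pres : is_presentation gen Rel.
Hypothesis rel_neq0 : forall r, Rel r -> r <> [::].
Hypothesis rel_reduced : forall r, Rel r -> cyclically_reduced r.
Hypothesis small6 : forall r r' p : word S,
  symmetrized Rel r -> symmetrized Rel r' -> r <> r' ->
  prefix p r -> prefix p r' -> 6 * size p < minn (size r) (size r').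

Lemma eval_rel r : Rel r -> eval_word gen r = 1%g.
Proof.
move=> Rr; have := @presented_relator _ Rel [::] r [::] Rr.
by rewrite /= cats0 => /(pres.2 _ _).
Qed.

Lemma eval_rot n w : eval_word gen w = 1%g -> eval_word gen (rot n w) = 1%g.
Proof.
rewrite -{1}(cat_take_drop n w) /rot !eval_word_cat => e.
by apply: (mulgI (eval_word gen (take n w))); rewrite mulgA e mul1g mulg1.
Qed.

Lemma sym_eval w : symmetrized Rel w -> eval_word gen w = 1%g.
Proof.
case=> r /eval_rel Rr [k [->|->]]; apply: eval_rot => //.
by rewrite eval_inv_word Rr invg1.
Qed.

Lemma sym_neq0 w : symmetrized Rel w -> w <> [::].
Proof.
case=> r Rr [k e] w0; apply: (rel_neq0 Rr); apply/size0nil.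
by case: e => /(congr1 size); rewrite w0 size_rot ?size_inv_word.
Qed.

Lemma sym_reduced w : symmetrized Rel w -> cyclically_reduced w.
Proof.
case=> r /rel_reduced Rr [k [->|->]]; rewrite cyclically_reduced_rot //.
exact: cyclically_reduced_inv.
Qed.

Lemma van_kampen w : w <> [::] -> eval_word gen w = 1%g -> exists k, bounds Rel k w.
Proof.
move=> w0 ew; have /(pres.2 w [::]) weq : eval_word gen w = eval_word gen [::] by [].
have := bounds_presented [::] [::] weq; rewrite /= cats0 => -[_]; apply.
by case: w w0 {ew weq} => // a w _; exists 0; exact: bounds_nil.
Qed.

Lemma exists_geodesic w : exists q,
  [/\ geodesic gen q, eval_word gen q = eval_word gen w & size q <= size w].
Proof.
have [n] := ubnP (size w); elim: n w => // n IH w wn.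
have [gw|] := pselect (geodesic gen w); first by exists w.
move=> /existsNP[w' /not_implyP[ew /negP]]; rewrite -ltnNge => lt.
have [|q [gq eq sq]] := IH w'; first by lia.
by exists q; split=> //; [rewrite eq|lia].
Qed.

Lemma geodesic_inv w : geodesic gen w -> geodesic gen (inv_word w).
Proof.
move=> gw w' e; rewrite size_inv_word -(size_inv_word w'); apply: gw.
by rewrite eval_inv_word e eval_inv_word invgK.
Qed.

(** The loop formed by [p] and a geodesic with the same ends bounds a diagram, to
    which [geodesic_of_relator] applies. *)
Lemma geodesic_arc p h q : symmetrized Rel (p ++ h) -> geodesic gen q ->
  eval_word gen q = eval_word gen p -> q = p \/ q = inv_word h.
Proof.
move=> Rph gq eq.
have [/eqP|/eqP pq0] := eqVneq (p ++ inv_word q) [::].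
  rewrite -size_eq0 size_cat size_inv_word addn_eq0 !size_eq0 => /andP[/eqP-> /eqP->].
  by left.
have e1 : eval_word gen (p ++ inv_word q) = 1%g.
  by rewrite eval_word_cat eval_inv_word eq mulgV.
have [k Dk] := van_kampen pq0 e1.
have := geodesic_of_relator sym_neq0 sym_eval sym_reduced small6 Rph (geodesic_inv gq) e1 Dk.
by case=> /(congr1 (@inv_word S)); rewrite !inv_wordK; [left|right].
Qed.

Lemma arc_length p h w : symmetrized Rel (p ++ h) ->
  eval_word gen w = eval_word gen p -> minn (size p) (size h) <= size w.
Proof.
move=> Rph ew; have [q [gq eq sq]] := exists_geodesic w.
apply: leq_trans sq; rewrite ew in eq.
by case: (geodesic_arc Rph gq eq) => ->; rewrite ?size_inv_word ?geq_minl ?geq_minr.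
Qed.

Lemma half_geodesic p h : symmetrized Rel (p ++ h) -> size p <= size h -> geodesic gen p.
Proof. by move=> Rph le w /(arc_length Rph); rewrite (minn_idPl le). Qed.

Definition midpoint r : G := eval_word gen (take (size r)./2 r).

(** If the midpoints agree, the first half of [r'] is a geodesic to the midpoint of
    [r], so it is the first half of [r] or the second half read backwards. In both
    cases [r] shares about half of its length with a cyclic conjugate of [r'] or of
    its inverse, which is far more than a sixth. *)
Lemma midpoint_inj r r' : irredundant Rel -> Rel r -> Rel r' -> 1 < size r ->
  midpoint r = midpoint r' -> r = r'.
Proof.
move=> irr Rr Rr' r1; rewrite /midpoint.
set p := take _ r; set p' := take _ r' => emid.
pose h := drop (size r)./2 r; pose h' := drop (size r')./2 r'.
have er : r = p ++ h by rewrite cat_take_drop.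
have er' : r' = p' ++ h' by rewrite cat_take_drop.
have sp : size p = (size r)./2 by rewrite size_take; have := odd_double_half (size r); case: ifP; lia.
have sh : size h = size r - (size r)./2 by rewrite size_drop.
have sp' : size p' = (size r')./2 by rewrite size_take; have := odd_double_half (size r'); case: ifP; lia.
have sh' : size h' = size r' - (size r')./2 by rewrite size_drop.
have symr := symmetrized_base Rr; have symr' := symmetrized_base Rr'.
have gp' : geodesic gen p'.
  by apply: (@half_geodesic p' h'); rewrite -?er' // sp' sh'; have := odd_double_half (size r'); lia.
have [ep|ep] : p' = p \/ p' = inv_word h.
  by apply: geodesic_arc => //; rewrite -er.
  have [//|nr] := pselect (r = r'); exfalso.
  have pr : prefix p r by rewrite er prefix_prefix.
  have pr' : prefix p r' by rewrite -ep er' prefix_prefix.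
  have := small6 symr symr' nr pr pr'; rewrite leq_min => /andP[lt _].
  by move: lt; rewrite sp; have := odd_double_half (size r); move: r1; clear; lia.
have symh : symmetrized Rel (h ++ p) by apply: symmetrized_catC; rewrite -er.
have symp' : symmetrized Rel (h ++ inv_word h').
  rewrite -[h in h ++ _]inv_wordK -ep; apply: symmetrized_catC.
  by rewrite -inv_word_cat -er'; apply: symmetrized_inv.
have eh : h' = inv_word p.
  have [//|nh] := pselect (h' = inv_word p); exfalso.
  have nh2 : h ++ p <> h ++ inv_word h'.
    by move=> /eqP; rewrite eqseq_cat // eqxx /= => /eqP e; apply: nh; rewrite e inv_wordK.
  have := small6 symh symp' nh2 (prefix_prefix _ _) (prefix_prefix _ _).
  rewrite leq_min => /andP[lt _].
  by move: lt; rewrite !size_cat sh sp; have := odd_double_half (size r); move: r1; clear; lia.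
apply/esym; apply: (irr _ _ 0) => //; right.
by rewrite rot0 er inv_word_cat er' ep eh.
Qed.

End Presentation.

(** * Distances in the Cayley graph *)

Local Open Scope classical_set_scope.
Local Open Scope ring_scope.

Section CayleyMetric.
Variables (R : realType) (S : finType) (G : groupType) (gen : S -> G).
Hypothesis gen_surj : forall g : G, exists w, eval_word gen w = g.
Implicit Types (x y : G) (w : word S).
Local Notation e := (cayley gen).
Local Notation gd := (gdist R (cayley gen)).

Lemma cayley_edge x (a : letter S) :
  eval_letter gen a <> 1%g -> e x (x * eval_letter gen a)%g.
Proof.
move=> a1; apply/andP; split.
  by apply/eqP => /(congr1 (fun g => (x^-1 * g)%g)); rewrite mulVg mulKg => /esym.
apply/existsP; case: a a1 => s [] _; exists s; rewrite /eval_letter /= ?eqxx //.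
by rewrite mulgVK eqxx orbT.
Qed.

Lemma cayley_letter x y : e x y -> exists a, y = (x * eval_letter gen a)%g.
Proof.
move=> /andP[_ /existsP[s /orP[/eqP->|/eqP->]]]; first by exists (s, false).
by exists (s, true); rewrite /eval_letter /= mulgK.
Qed.

Lemma walk_word x y p : is_walk e x y p ->
  exists w, size w = size p /\ (x * eval_word gen w)%g = y.
Proof.
elim: p x => [|z p IH] x; rewrite /is_walk /=.
  by move=> /eqP<-; exists [::]; rewrite /= mulg1.
move=> /andP[/andP[/cayley_letter[a ->] pz] lz].
have [|w [sw ew]] := IH (x * eval_letter gen a)%g; first by rewrite /is_walk pz lz.
by exists (a :: w); rewrite /= sw mulgA.
Qed.

Lemma word_walk x w :
  exists p, is_walk e x (x * eval_word gen w)%g p /\ (size p <= size w)%N.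
Proof.
elim: w x => [|a w IH] x; first by exists [::]; rewrite /is_walk /= mulg1 eqxx.
have [p [wp sp]] := IH (x * eval_letter gen a)%g; rewrite -mulgA in wp.
have [a1|a1] := pselect (eval_letter gen a = 1%g).
  exists p; rewrite /= a1 mul1g; rewrite a1 mulg1 mul1g in wp; split=> //.
  exact: leq_trans sp (leqnSn _).
exists ((x * eval_letter gen a)%g :: p); split=> //.
by move: wp; rewrite /is_walk /= cayley_edge.
Qed.

Let dists x y : set R := [set (size p)%:R | p in [set p | is_walk e x y p]].

Let dists_lb x y : has_lbound (dists x y).
Proof. by exists 0 => _ [p _ <-]. Qed.

Lemma gdist_le x w : gd x (x * eval_word gen w)%g <= (size w)%:R.
Proof.
have [p [wp sp]] := word_walk x w.
apply: (@le_trans _ _ (size p)%:R); last by rewrite ler_nat.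
by apply: ge_inf; [exact: dists_lb|exists p].
Qed.

Lemma gdist_ge x y m : (forall w, (x * eval_word gen w)%g = y -> (m <= size w)%N) ->
  m%:R <= gd x y.
Proof.
move=> mw; apply: lb_le_inf.
  have [w ew] := gen_surj (x^-1 * y)%g; have [p [wp _]] := word_walk x w.
  by exists (size p)%:R, p => //; move: wp; rewrite /= ew mulVKg.
move=> _ [p /walk_word[w [<- ew]] <-]; rewrite ler_nat; exact: mw.
Qed.

Lemma gdist_ge0 x y : 0 <= gd x y.
Proof. exact: (@gdist_ge x y 0%N). Qed.

Lemma finite_words n : finite_set [set w : word S | (size w <= n)%N].
Proof.
pose l := flatten [seq map val (enum {: k.-tuple (letter S)}) | k <- iota 0 n.+1].
apply: (@sub_finite_set _ _ [set` l]); last exact: finite_seq.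
move=> w /= wn; apply/flattenP; exists (map val (enum {: (size w).-tuple (letter S)})).
  by apply/mapP; exists (size w) => //; rewrite mem_iota /= add0n ltnS.
by apply/mapP; exists (in_tuple w); rewrite // mem_enum.
Qed.

Lemma finite_vertex_ball x n : finite_set (vertex_ball e x (n%:R : R)).
Proof.
apply: (@sub_finite_set _ _
  ((fun w => (x * eval_word gen w)%g) @` [set w : word S | (size w <= n)%N])); last first.
  exact/finite_image/finite_words.
move=> y; rewrite /vertex_ball /= => xy.
have [//|nw] := pselect (exists2 w, (size w <= n)%N & (x * eval_word gen w)%g = y).
have : (n.+1)%:R <= gd x y.
  by apply: gdist_ge => w ew; rewrite ltnNge; apply/negP => wn; apply: nw; exists w.
by move=> /le_trans/(_ xy); rewrite ler_nat ltnn.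
Qed.

End CayleyMetric.

Section FarPoints.
Variables (R : realType) (V : choiceType) (e : rel V).
Local Notation gd := (gdist R e).
Hypothesis gd_ge0 : forall x y, 0 <= gd x y.

Lemma pdist_vertex_le (u w y : V) (t : R) : 0 <= t <= 1 ->
  pdist e (u, w, t) (vertex_point R y) <= 1 + gd u y /\
  pdist e (u, w, t) (vertex_point R y) <= 1 + gd w y.
Proof.
move=> /andP[t0 t1].
have gu := gd_ge0 u y; have gw := gd_ge0 w y.
have vu : vdist e (u, w, t) y <= 1 + gd u y.
  by rewrite /vdist ge_min; apply/orP; left; lra.
have vw : vdist e (u, w, t) y <= 1 + gd w y.
  by rewrite /vdist ge_min; apply/orP; right; lra.
have : pdist e (u, w, t) (vertex_point R y) <= vdist e (u, w, t) y.
  rewrite /pdist /vertex_point; set d := Num.min (0 + _) _.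
  have dv : d <= vdist e (u, w, t) y by rewrite /d ge_min; apply/orP; left; rewrite add0r.
  by case: ifP => _; [|case: ifP => _] => //; rewrite ge_min dv.
by move=> pv; split; apply: le_trans pv _.
Qed.

Lemma pdist_ge (D : R) (u w u' w' : V) (t t' : R) :
  0 <= t <= 1 -> 0 <= t' <= 1 -> u != u' -> u != w' ->
  D <= gd u u' -> D <= gd u w' -> D <= gd w u' -> D <= gd w w' ->
  D <= pdist e (u, w, t) (u', w', t').
Proof.
move=> /andP[t0 t1] /andP[t0' t1'] uu uw d1 d2 d3 d4.
rewrite /pdist !xpair_eqE (negPf uu) (negPf uw) /= !le_min.
by apply/andP; split; rewrite -lerBlDl le_min; apply/andP; split; lra.
Qed.

(** A point of an edge outside the neighbourhood has both endpoints of this edge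
    nearly as far away, with an error of at most the length of the edge. *)
Lemma outside_nbhd (C : R) (x0 x u w : V) (t : R) : 0 <= t <= 1 ->
  realization e (u, w, t) ->
  ~ nbhd e C [set vertex_point R x0; vertex_point R x] (u, w, t) ->
  forall y, y = x0 \/ y = x -> C - 1 < gd u y /\ C - 1 < gd w y.
Proof.
move=> t01 rq nB y yx.
have : C < pdist e (u, w, t) (vertex_point R y).
  rewrite ltNge; apply/negP => le; apply: nB; split=> //.
  apply: (@le_trans _ _ (pdist e (u, w, t) (vertex_point R y))%:E); last by rewrite lee_fin.
  apply: ereal_inf_lbound; exists (u, w, t), (vertex_point R y); split=> //=.
  by case: yx => ->; [left|right].
by have [h1 h2] := pdist_vertex_le u w y t01; split; lra.
Qed.

End FarPoints.

(** * The bigon cut out by a relator *)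

Section Iota.
Variables (V : eqType) (e : rel V) (f : nat -> V).
Local Open Scope nat_scope.

Lemma walk_iota k l : (forall i, k <= i < k + l -> e (f i) (f i.+1)) ->
  path e (f k) (map f (iota k.+1 l)) && (last (f k) (map f (iota k.+1 l)) == f (k + l)).
Proof.
elim: l k => [|l IH] k ef /=; first by rewrite addn0 eqxx.
rewrite ef /=; last by lia.
by have := IH k.+1; rewrite addSnnS; apply => i ik; apply: ef; lia.
Qed.

Lemma zip_iota k l u w :
  (u, w) \in zip (f k :: map f (iota k.+1 l)) (map f (iota k.+1 l)) ->
  exists i, [/\ k <= i < k + l, u = f i & w = f i.+1].
Proof.
elim: l k => [|l IH] k //=; rewrite in_cons => /orP[/eqP[-> ->]|/IH[i [ik -> ->]]].
  by exists k; split=> //; lia.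
by exists i; split=> //; lia.
Qed.

End Iota.

Lemma trace_iota (R : realType) (V : choiceType) (e : rel V) (f : nat -> V) l (q : Defs.point R V) :
  (forall i, (i < l)%N -> e (f i) (f i.+1)) ->
  trace (R := R) (f 0%N) (map f (iota 1 l)) q ->
  exists i j, [/\ (i <= l)%N, (j <= l)%N, q = (f i, f j, q.2), 0 <= q.2 <= 1 & realization e q].
Proof.
move=> ef [[y ys ->]|[qz q01]].
  have : y \in map f (iota 0 l.+1) by [].
  move=> /mapP[i]; rewrite mem_iota /= add0n ltnS => il ->.
  by exists i, i; split=> //=; [rewrite lexx ler01|right; exists (f i)].
case: q q01 qz => [[u w] t] /= q01 /zip_iota[i [/andP[_ il] -> ->]].
exists i, i.+1; split=> //; first exact: ltnW.
by left; split=> //=; apply: ef.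
Qed.

Section RelatorLoop.
Variables (R : realType) (S : finType) (G : groupType) (gen : S -> G) (Rel : set (word S)).
Hypothesis pres : is_presentation gen Rel.
Hypothesis rel_neq0 : forall r, Rel r -> r <> [::].
Hypothesis rel_reduced : forall r, Rel r -> cyclically_reduced r.
Hypothesis small6 : forall r r' p : word S,
  symmetrized Rel r -> symmetrized Rel r' -> r <> r' ->
  prefix p r -> prefix p r' -> (6 * size p < minn (size r) (size r'))%N.
Variables (x0 : G) (r : word S).
Hypothesis Rr : Rel r.
Hypothesis r_gt1 : (1 < size r)%N.

Local Notation e := (cayley gen).
Local Notation gd := (gdist R (cayley gen)).
Let n := size r.
Let m := n./2.
Definition loop_vertex i : G := (x0 * eval_word gen (take i r))%g.
Local Notation v := loop_vertex.

Let v0 : v 0 = x0. Proof. by rewrite /v take0 /= mulg1. Qed.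
Let vn : v n = x0. Proof. by rewrite /v take_size (eval_rel pres Rr) mulg1. Qed.

Let sub_word i j : (i <= j <= n)%N -> exists w h, [/\ size w = (j - i)%N,
  size h = (n - (j - i))%N, symmetrized Rel (w ++ h) & v j = (v i * eval_word gen w)%g].
Proof.
move=> /andP[ij jn]; pose w := drop i (take j r).
have ej : take j r = take i r ++ w.
  by rewrite -{1}(cat_take_drop i (take j r)) take_takel.
have er : rot i r = w ++ (drop j r ++ take i r).
  have : take i r ++ drop i r = take i r ++ (w ++ drop j r).
    by rewrite catA -ej !cat_take_drop.
  by move=> /eqP; rewrite eqseq_cat // eqxx /rot => /eqP ->; rewrite -catA.
exists w, (drop j r ++ take i r); split.
- by rewrite size_drop size_takel.
- by rewrite size_cat size_drop size_takel ?(leq_trans ij) // -/n; move: ij jn; clear; lia.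
- by rewrite -er; apply/symmetrized_rot/symmetrized_base.
- by rewrite /v ej eval_word_cat mulgA.
Qed.

(** Together with [loop_dist_le], this says that the relator loop is isometrically
    embedded. *)
Lemma loop_dist_ge i j : (i <= j <= n)%N ->
  (minn (j - i) (n - (j - i)))%:R <= gd (v i) (v j) /\
  (minn (j - i) (n - (j - i)))%:R <= gd (v j) (v i).
Proof.
move=> /sub_word[w [h [sw sh Rwh ev]]]; rewrite -sh -sw.
have key w' : eval_word gen w' = eval_word gen w -> (minn (size w) (size h) <= size w')%N.
  exact: (arc_length pres rel_neq0 rel_reduced small6 Rwh).
split; apply: gdist_ge; try exact: pres.1.
  by move=> w'; rewrite ev => /mulgI; exact: key.
move=> w' ew; rewrite -(size_inv_word w'); apply: key.
rewrite eval_inv_word; apply: (mulgI (v i)); rewrite -ev -{1}ew.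
by rewrite mulgK.
Qed.

Lemma loop_dist_le i j : (i <= j <= n)%N ->
  gd (v i) (v j) <= (j - i)%:R /\ gd (v j) (v i) <= (j - i)%:R.
Proof.
move=> /sub_word[w [h [<- _ _ ->]]]; split; first exact: gdist_le.
rewrite -(size_inv_word w) -{2}[v i](mulgK (eval_word gen w)) -eval_inv_word.
exact: gdist_le.
Qed.

Lemma loop_vertex_neq i j : (i < j <= n)%N -> (j - i < n)%N -> v i != v j.
Proof.
move=> /andP[ij jn] lt; apply/eqP => eij.
have [|w [h [sw sh Rwh ev]]] := @sub_word i j; first by rewrite (ltnW ij).
have := arc_length pres rel_neq0 rel_reduced small6 (w := [::]) Rwh.
rewrite /= sw sh leqn0 => le.
have : minn (j - i) (n - (j - i)) == 0%N.
  by apply: le; apply: (mulgI (v i)); rewrite -ev mulg1.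
by move: ij lt; clear; lia.
Qed.

Let edge i : (i < n)%N -> e (v i) (v i.+1) /\ e (v i.+1) (v i).
Proof.
move=> lt; have [|w [h [sw _ _ ev]]] := @sub_word i i.+1; first by rewrite leqnSn.
case: w sw ev => [|a [|b w]]; rewrite subSnn //= mulg1 => _ ev.
have a1 : eval_letter gen a <> 1%g.
  move=> a1; have := @loop_vertex_neq i i.+1; rewrite ltnSn lt subSnn r_gt1 ev a1 mulg1 eqxx.
  by move=> /(_ isT isT).
rewrite ev cayley_edge //; split=> //.
rewrite -{2}[v i](mulgK (eval_letter gen a)) -eval_inv_letter.
apply: cayley_edge; rewrite eval_inv_letter => /(congr1 (fun g => g^-1)%g).
by rewrite invgK invg1.
Qed.

(** Both arcs from [v i] to [v j] run past one of the two ends [v 0] and [v m] of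
    the bigon, and each of the two vertices is at distance at least [c] from it. *)
Let far (c : R) i j : 0 < c -> (i <= m <= j)%N -> (j <= n)%N ->
  c <= i%:R -> c <= (m - i)%:R -> c <= (j - m)%:R -> c <= (n - j)%:R ->
  v i != v j /\ c + c <= gd (v i) (v j).
Proof.
move=> c0 /andP[im mj] jn ci cmi cjm cnj.
have pos k : c <= k%:R -> (0 < k)%N by move=> ck; rewrite -(ltr0n R); apply: lt_le_trans ck.
have i0 := pos _ ci; have mi0 := pos _ cmi; have jm0 := pos _ cjm; have nj0 := pos _ cnj.
split; first by apply: loop_vertex_neq; move: i0 mi0 jm0 nj0; rewrite -/n; clear; lia.
apply: le_trans (loop_dist_ge (i := i) (j := j) _).1; last first.
  by rewrite (leq_trans im mj).
have [le|le] := leqP (j - i) (n - (j - i)).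
  have -> : (j - i = (m - i) + (j - m))%N by move: im mj; clear; lia.
  by rewrite natrD lerD.
have -> : (n - (j - i) = i + (n - j))%N by move: im mj jn; clear; lia.
by rewrite natrD lerD.
Qed.

Let near_ends (C : R) i j t y : 0 <= t <= 1 -> realization e (v i, v j, t) ->
  ~ nbhd e C [set vertex_point R x0; vertex_point R (v m)] (v i, v j, t) ->
  y = x0 \/ y = v m -> C - 1 < gd (v i) y /\ C - 1 < gd (v j) y.
Proof. by move=> t01 rq nB; apply: (outside_nbhd _ t01 rq nB) => a b; exact: gdist_ge0 pres.1 _ _. Qed.

(** Removing balls of radius [s + 2] at the ends leaves vertices which are at least
    [s + 1] away from the ends along the loop, hence a distance of at least
    [2 * (s + 1)] between the two halves. *)
Lemma relator_bigon (s : R) : 0 <= s ->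
  bigon e 2 s (s + 2) x0 (x0 * midpoint gen r)%g
    (map v (iota 1 m)) (map (fun i => v (n - i)) (iota 1 (n - m))).
Proof.
move=> s0; rewrite /bigon -/m -[(x0 * midpoint gen r)%g]/(v m).
have n2 : (m <= n - m <= m.*2)%N.
  by rewrite /m; have := odd_double_half n; move: r_gt1; rewrite -/n; clear; lia.
have mn : (m <= n)%N by move: n2; clear; lia.
have nm : (n - (n - m) = m)%N by rewrite subKn.
have dm : m%:R <= gd x0 (v m).
  have := (@loop_dist_ge 0 m mn).1; rewrite v0 subn0.
  by rewrite (minn_idPl _) //; case/andP: n2.
have e1 i : (i < m)%N -> e (v i) (v i.+1).
  by move=> im; apply: (edge _).1; apply: leq_trans mn.
pose f2 i := v (n - i).
have e2 i : (i < n - m)%N -> e (f2 i) (f2 i.+1).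
  move=> im; rewrite /f2 (_ : n - i = (n - i.+1).+1)%N; last by move: im; clear; lia.
  by apply: (edge _).2; move: im; clear; lia.
have f20 : f2 0%N = x0 by rewrite /f2 subn0 vn.
have trace1 q : trace x0 (map v (iota 1 m)) q -> exists i j,
    [/\ (i <= m)%N, (j <= m)%N, q = (v i, v j, q.2), 0 <= q.2 <= 1 & realization e q].
  by rewrite -{1}v0 => /(trace_iota e1).
have trace2 q : trace x0 (map f2 (iota 1 (n - m))) q -> exists i j,
    [/\ (m <= i <= n)%N, (m <= j <= n)%N, q = (v i, v j, q.2), 0 <= q.2 <= 1 & realization e q].
  rewrite -{1}f20 => /(trace_iota e2)[i [j [il jl eq q01 rq]]].
  exists (n - i)%N, (n - j)%N; split=> //; first by move: il mn; clear; lia.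
  by move: jl mn; clear; lia.
split.
- have := @walk_iota _ e f2 0 (n - m) (fun i h => e2 i h).
  have := @walk_iota _ e v 0 m (fun i h => e1 i h).
  by rewrite v0 f20 !add0n /f2 nm.
- rewrite size_map size_iota; apply: (le_trans dm); have := gdist_ge0 R pres.1 x0 (v m); lra.
- rewrite size_map size_iota; apply: (@le_trans _ _ (m.*2)%:R).
    by rewrite ler_nat; case/andP: n2.
  by rewrite -muln2 natrM mulrC ler_pM2l.
apply: (@lt_le_trans _ _ (s + 1 + (s + 1))%:E); first by rewrite lte_fin; lra.
apply: le_ereal_inf_tmp => _ [q [q' [[/trace1 [i [j [im jm eq q01 rq]]] qB]
  [/trace2 [k [l [/andP[mk kn] /andP[ml ln] eq' q01' rq']]] qB'] ->]]].
rewrite lee_fin; rewrite eq in rq qB *; rewrite eq' in rq' qB' *.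
have h1 := near_ends q01 rq qB (or_introl erefl).
have h2 := near_ends q01 rq qB (or_intror erefl).
have h3 := near_ends q01' rq' qB' (or_introl erefl).
have h4 := near_ends q01' rq' qB' (or_intror erefl).
have c0 : 0 < s + 1 by lra.
have left_end a : (a <= m)%N -> s + 2 - 1 < gd (v a) x0 -> s + 2 - 1 < gd (v a) (v m) ->
    s + 1 <= a%:R /\ s + 1 <= (m - a)%:R.
  move=> am g1 g2; split.
    have := (@loop_dist_le 0 a (leq_trans am mn)).2; rewrite v0 subn0; lra.
  have am' : (a <= m <= n)%N by rewrite am.
  by have := (loop_dist_le am').1; lra.
have right_end a : (m <= a)%N -> (a <= n)%N -> s + 2 - 1 < gd (v a) x0 ->
    s + 2 - 1 < gd (v a) (v m) -> s + 1 <= (a - m)%:R /\ s + 1 <= (n - a)%:R.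
  move=> ma an g1 g2; split.
    have am' : (m <= a <= n)%N by rewrite ma.
    by have := (loop_dist_le am').2; lra.
  have an' : (a <= n <= n)%N by rewrite an leqnn.
  by have := (loop_dist_le an').1; rewrite vn; lra.
have [i1 i2] := left_end _ im h1.1 h2.1; have [j1 j2] := left_end _ jm h1.2 h2.2.
have [k1 k2] := right_end _ mk kn h3.1 h4.1; have [l1 l2] := right_end _ ml ln h3.2 h4.2.
have between a b : (a <= m)%N -> (m <= b)%N -> (a <= m <= b)%N by move=> -> ->.
have [n1 g1] := far c0 (between i k im mk) kn i1 i2 k1 k2.
have [n3 g2] := far c0 (between i l im ml) ln i1 i2 l1 l2.
have [_ g3] := far c0 (between j k jm mk) kn j1 j2 k1 k2.
have [_ g4] := far c0 (between j l jm ml) ln j1 j2 l1 l2.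
exact: pdist_ge.
Qed.

End RelatorLoop.

(** * Counting midpoints *)

Lemma card_fset_set_inj (T U : choiceType) (A : set T) (B : set U) (f : T -> U) :
  finite_set A -> finite_set B -> {in A &, injective f} -> f @` A `<=` B ->
  (#|` fset_set A| <= #|` fset_set B|)%N.
Proof.
move=> fA fB inj_f fAB.
have <- : #|` [fset f x | x in fset_set A]%fset| = #|` fset_set A|.
  by apply: card_in_imfset => x y; rewrite /= !in_fset_set //; exact: inj_f.
apply: fsubset_leq_card; apply/fsubsetP => _ /imfsetP[x /= xA ->].
rewrite in_fset_set // inE in xA; rewrite in_fset_set // inE.
by apply: fAB; exists x.
Qed.

Theorem proposition3p5 (R : realType) (S : finType) (G : groupType)
    (gen : S -> G) (Rel : set (word S))
    (hpres : is_presentation gen Rel)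
    (hred : forall r, Rel r -> cyclically_reduced r)
    (hirr : irredundant Rel)
    (hC6 : small_cancellation (6^-1 : R) Rel)
    (d C : R) (hd : 1 < d) (hC : 0 <= C)
    (I : set nat) (hI : infinite_set I)
    (hgrowth : forall n, I n ->
      d ^+ n < #|` fset_set [set r | [/\ Rel r, n%:R - C <= (size r)%:R &
                                      (size r <= n)%N]]|%:R) :
  forall x0 : G, exp_many_fat_bigons R (cayley gen) x0.
Proof.
move=> x0.
pose A n := [set r | [/\ Rel r, n%:R - C <= (size r)%:R & (size r <= n)%N]].
have finA n : finite_set (A n).
  by apply: sub_finite_set (finite_words S n) => r [].
have small6 : forall r r' p : word S,
    symmetrized Rel r -> symmetrized Rel r' -> r <> r' ->
    prefix p r -> prefix p r' -> (6 * size p < minn (size r) (size r'))%N.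
  move=> r r' p sr sr' rr' pr pr'; have := hC6 r r' p sr sr' rr' pr pr'.
  by rewrite mulrC ltr_pdivlMr // -natrM ltr_nat mulnC.
have rel_neq0 : forall r, Rel r -> r <> [::].
  move=> r Rr r0.
  (* The empty word is a common prefix of any two relators, and the small
     cancellation inequality fails for it if one of them is empty. *)
  have all_nil r' : Rel r' -> r' = [::].
    move=> Rr'; have [//|n0] := pselect (r' = [::]); exfalso.
    have := small6 r r' [::] (symmetrized_base Rr) (symmetrized_base Rr').
    by rewrite r0 !prefix0s min0n => /(_ (fun e => n0 (esym e)) isT isT).
  have [n In] : I !=set0 by apply/set0P/negP => /eqP I0; apply: hI; rewrite I0.
  have := hgrowth n In; apply/negP; rewrite -leNgt.
  apply: (@le_trans _ _ 1); last by rewrite exprn_ege1 // ltW.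
  have := @card_fset_set_inj _ _ (A n) [set ([::] : word S)] id (finA n) (finite_set1 _).
  rewrite fset_set1 cardfs1 -(ler_nat R); apply; first by move=> ? ?.
  by move=> _ [r' [/all_nil-> _ _] <-].
exists 2, d, 2; split; rewrite ?ltr1n // => s s2.
exists (s + 2); first by lra.
(* Beyond this bound all the relators that are counted have at least two
   letters, so that the two halves of the loop are non-trivial paths. *)
have infI : infinite_set (I `\` [set n | n%:R <= C + 2]).
  move=> finD; apply: hI.
  apply: (@sub_finite_set _ _ ((I `\` [set n | n%:R <= C + 2]) `|` `I_(Num.bound (C + 2)))).
    move=> n In; have [nC|nC] := pselect (n%:R <= C + 2); last by left.
    right; rewrite /= -(ltr_nat R); apply: le_lt_trans nC _.
    by apply: archi_boundP; lra.
  by rewrite finite_setU; split=> //; exact: finite_II.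
move=> fin; apply: infI; apply: sub_finite_set fin => n [In /= /negP]; rewrite -ltNge => nC.
apply: le_trans (ltW (hgrowth n In)) _; rewrite ler_nat.
have size2 r : A n r -> (1 < size r)%N.
  by case=> _ h _; rewrite -(ltr_nat R); lra.
apply: (@card_fset_set_inj _ _ (A n) _ (fun r => x0 * midpoint gen r)%g) => //.
- by apply: sub_finite_set (finite_vertex_ball R hpres.1 x0 n); exact: subIsetr.
- move=> r r'; rewrite !inE => Ar Ar' /mulgI.
  apply: (midpoint_inj hpres rel_neq0 hred small6 hirr) => //.
  + by case: Ar.
  + by case: Ar'.
  + exact: size2.
move=> _ [r Ar <-]; have [Rr _ rn] := Ar; split.
  eexists; eexists; apply: (relator_bigon hpres rel_neq0 hred small6 _ Rr (size2 _ Ar)).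
  by lra.
apply: le_trans (gdist_le R gen x0 _) _; rewrite ler_nat.
by apply: leq_trans rn; rewrite size_take; case: ifP => // /ltnW.
Qed.
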